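(* Let $\mathbb{F}$ be a field of characteristic different from $2$. The Faulkner construction gives a bijective correspondence between isomorphism classes of objects $(L,M,b)$ of $\mathbf{FLSM}$ and isomorphism classes of objects $(\mathcal{V},\langle\cdot,\cdot\rangle)$ of $\mathbf{GJSP}$: to $(L,M,b)$ is associated $\mathcal{V}_{L,M}=(M^*,M)$ with its pairing form, and, inversely, to $(\mathcal{V},\langle\cdot,\cdot\rangle)$ is associated $(\mathfrak{instr}(\mathcal{V}),\mathcal{V}^+,b)$. This correspondence restricts to a bijective correspondence between isomorphism classes of objects of $\mathbf{FLM}$ and isomorphism classes of objects of $\mathbf{GJP}$. Furthermore, if $(L,M,b)\in\mathbf{FLSM}$ and $(\mathcal{V},\langle\cdot,\cdot\rangle)\in\mathbf{GJSP}$ are associated objects, then there is an isomorphism of affine group schemes over $\mathbb{F}$ $$\mathbf{Aut}(L,M,b)\simeq\mathbf{Aut}(\mathcal{V},\langle\cdot,\cdot\rangle).$$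
   Context: The base field $\mathbb{F}$ has characteristic different from $2$. For a $\mathbb{Z}_2$-graded space, $\varepsilon$ denotes the parity of nonzero homogeneous elements (and of homogeneous linear maps); put $\eta_{x,y}:=(-1)^{\varepsilon(x)\varepsilon(y)}$ and $\eta_{x,y,z}:=(-1)^{\varepsilon(x)\varepsilon(y)+\varepsilon(y)\varepsilon(z)+\varepsilon(z)\varepsilon(x)}$. Identities below are for homogeneous elements. **Lie superalgebras.** A Lie superalgebra is a $\mathbb{Z}_2$-graded algebra $L=L_{\bar0}\oplus L_{\bar1}$ with $[x,y]=-\eta_{x,y}[y,x]$ and $[x,[y,z]]=[[x,y],z]+\eta_{x,y}[y,[x,z]]$. An $L$-supermodule is a $\mathbb{Z}_2$-graded space $M$ with a bilinear action such that $L_a\cdot M_c\subseteq M_{a+c}$ and $[x,y]\cdot v=x\cdot(y\cdot v)-\eta_{x,y}\,y\cdot(x\cdot v)$. A bilinear form $b$ on $L$ is homogeneous if $b(x,y)=0$ whenever $\varepsilon(x)\ne\varepsilon(y)$; invariant if $b([x,y],z)=b(x,[y,z])$; supersymmetric if $b(x,y)=\eta_{x,y}b(y,x)$. For $M$ finite-dimensional, the (left) dual supermodule $M^*$ is the dual space with the dual grading ($f\in M^*_a$ vanishes on $M_c$ for $c\neq a$) and action $(x\cdot f)(v)=-\eta_{x,f}f(x\cdot v)$. **Generalized Jordan superpairs.** A generalized Jordan superpair is a pair $\mathcal{V}=(\mathcal{V}^-,\mathcal{V}^+)$ of $\mathbb{Z}_2$-graded spaces with trilinear maps $\{\cdot,\cdot,\cdot\}^\sigma:\mathcal{V}^\sigma\times\mathcal{V}^{-\sigma}\times\mathcal{V}^\sigma\to\mathcal{V}^\sigma$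 ($\sigma=\pm$) that are compatible with the gradings, i.e. $\{\mathcal{V}^\sigma_a,\mathcal{V}^{-\sigma}_c,\mathcal{V}^\sigma_d\}^\sigma\subseteq\mathcal{V}^\sigma_{a+c+d}$, such that, writing $D^\sigma_{x,y}(z):=\{x,y,z\}^\sigma$ (with parity $\varepsilon(D^\sigma_{x,y})=\varepsilon(x)+\varepsilon(y)$), $$D^\sigma_{x,y}D^\sigma_{z,w}-\eta_{D_{x,y},D_{z,w}}D^\sigma_{z,w}D^\sigma_{x,y}=D^\sigma_{D^\sigma_{x,y}z,\,w}-\eta_{x,y,z}\,D^\sigma_{z,\,D^{-\sigma}_{y,x}w}$$ for $x,z\in\mathcal{V}^\sigma$, $y,w\in\mathcal{V}^{-\sigma}$. A bilinear form $\langle\cdot,\cdot\rangle:\mathcal{V}^-\times\mathcal{V}^+\to\mathbb{F}$ is homogeneous if $\langle x,y\rangle=0$ when $\varepsilon(x)\neq\varepsilon(y)$; superinvariant if $\langle D_{x,y}z,w\rangle=\eta_{x,y,z}\langle z,D_{y,x}w\rangle$; supersymmetric if $\langle D_{x,y}z,w\rangle=\eta_{D_{x,y},D_{z,w}}\langle D_{z,w}x,y\rangle$ and $\langle x,D_{y,z}w\rangle=\eta_{D_{x,y},D_{z,w}}\langle z,D_{w,x}y\rangle$, for $x,z\in\mathcal{V}^-$, $y,w\in\mathcal{V}^+$. For homogeneous $f\in\mathcal{V}^-$, $v\in\mathcal{V}^+$ put $\nu(f,v):=(D^-_{f,v},-\eta_{f,v}D^+_{v,f})\in\mathrm{End}(\mathcal{V}^-)\times\mathrm{End}(\mathcal{V}^+)$,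 extended bilinearly. The inner structure superalgebra $\mathfrak{instr}(\mathcal{V}):=\mathrm{span}\{\nu(f,v)\}$ is a Lie superalgebra under the superbracket $[p,q]=pq-\eta_{p,q}qp$ in $\mathrm{End}(\mathcal{V}^-\oplus\mathcal{V}^+)$, and it acts naturally on $\mathcal{V}^-$ and $\mathcal{V}^+$. **The classes.** $\mathbf{FLSM}$: triples $(L,M,b)$ with $L$ a finite-dimensional Lie superalgebra, $M$ a finite-dimensional faithful $L$-supermodule, $b:L\times L\to\mathbb{F}$ a nondegenerate homogeneous invariant supersymmetric bilinear form. An isomorphism $(L,M,b)\to(L',M',b')$ is a pair $(\varphi_0,\varphi^+)$, where $\varphi_0:L\to L'$ is an even (parity-preserving) algebra isomorphism and $\varphi^+:M\to M'$ is an even linear bijection, with $\varphi^+(x\cdot v)=\varphi_0(x)\cdot\varphi^+(v)$ and $b'(\varphi_0(x),\varphi_0(y))=b(x,y)$. $\mathbf{FLM}$: the subclass with $L_{\bar1}=0$, $M_{\bar1}=0$. $\mathbf{GJSP}$: pairs $(\mathcal{V},\langle\cdot,\cdot\rangle)$ with $\mathcal{V}$ a finite-dimensional generalized Jordan superpair and $\langle\cdot,\cdot\rangle:\mathcal{V}^-\times\mathcal{V}^+\to\mathbb{F}$ a nondegenerate homogeneous superinvariant supersymmetric bilinear form. An isomorphism is a pair $(\varphi^-,\varphi^+)$ of even linear bijections with $\varphi^\sigma(\{x,y,z\}^\sigma)=\{\varphi^\sigma(x),\varphi^{-\sigma}(y),\varphi^\sigma(z)\}^\sigma$ that preserves the bilinear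 forms. $\mathbf{GJP}$: the subclass with $\mathcal{V}^\pm_{\bar1}=0$. **The constructions.** (i) Given $(L,M,b)\in\mathbf{FLSM}$, let $\langle f,v\rangle:=f(v)$ and $\langle v,f\rangle:=\eta_{f,v}f(v)$ for $f\in M^*$, $v\in M$; let $[f,v],[v,f]\in L$ be the unique elements with $b(x,[f,v])=\langle x\cdot f,v\rangle$ and $b(x,[v,f])=\langle x\cdot v,f\rangle$ for all $x\in L$. Then $\mathcal{V}_{L,M}:=(M^*,M)$ has triple products $\{f,v,g\}^-:=[f,v]\cdot g$, $\{v,f,w\}^+:=[v,f]\cdot w$ and bilinear form $\langle\cdot,\cdot\rangle:M^*\times M\to\mathbb{F}$. (ii) Given $(\mathcal{V},\langle\cdot,\cdot\rangle)\in\mathbf{GJSP}$, take $L=\mathfrak{instr}(\mathcal{V})$, $M=\mathcal{V}^+$ and the bilinear form $b$ on $L$ determined by $b(\nu(f,v),\nu(g,w)):=\langle D^-_{f,v}g,w\rangle$. **Automorphism group schemes.** Let $R$ be a commutative associative unital $\mathbb{F}$-algebra, and extend forms, actions and products $R$-multilinearly to the objects obtained by the extension of scalars $-\otimes R$. $\mathbf{Aut}(L,M,b)$ is the affine group scheme whose $R$-points are the pairs $(\varphi_0,\varphi^+)$, where $\varphi_0$ is a parity-preserving $R$-algebra automorphism of $L\otimes R$ and $\varphi^+$ is a parity-preserving $R$-linear bijection of $M\otimes R$, with $\varphi^+(x\cdot v)=\varphi_0(x)\cdot\varphi^+(v)$ and $b(\varphi_0(x),\varphi_0(y))=b(x,y)$.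 $\mathbf{Aut}(\mathcal{V},\langle\cdot,\cdot\rangle)$ is the affine group scheme whose $R$-points are the pairs $(\varphi^-,\varphi^+)$ of parity-preserving $R$-linear bijections of $\mathcal{V}^-\otimes R$ and $\mathcal{V}^+\otimes R$ with $\varphi^\sigma(\{x,y,z\}^\sigma)=\{\varphi^\sigma(x),\varphi^{-\sigma}(y),\varphi^\sigma(z)\}^\sigma$ and $\langle\varphi^-(f),\varphi^+(v)\rangle=\langle f,v\rangle$. *)

(* Defs.v *)
From HB Require Import structures.
From mathcomp Require Import all_boot all_order all_algebra.
Set Implicit Arguments.
Unset Strict Implicit.
Unset Printing Implicit Defensive.
Import GRing.Theory.
Local Open Scope ring_scope.

(* Parities are booleans (false = even, true = odd) and add up with (+).      *)
(* Multilinear maps are curried elements of the 'Hom spaces of vector.v.      *)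

Section Signs.
Variable F : fieldType.

Definition eta (a c : bool) : F := (-1) ^+ (a && c).
Definition eta3 (a c d : bool) : F := eta a c * eta c d * eta d a.

End Signs.

(* [linfun] is only meaningful on functions that are linear: each use of      *)
(* [linfun2] below is followed by the evaluation lemma that justifies it.     *)
Section BilinearMaps.
Variables (F : fieldType) (U V W : vectType F).

Definition linfun2 (f : U -> V -> W) : 'Hom(U, 'Hom(V, W)) :=
  linfun (fun u => linfun (f u)).

Lemma linfun_val (X Y : vectType F) (f : X -> Y) : linear f -> linfun f =1 f.
Proof.
move=> flin.
pose m := GRing.isLinear.Build F X Y *:%R f flin.
pose g : {linear X -> Y} := HB.pack f m.
exact: (lfunE g).
Qed.

Lemma linfun2E (f : U -> V -> W) u v :
  (forall x, linear (f x)) -> (forall y, linear (f^~ y)) ->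
  linfun2 f u v = f u v.
Proof.
move=> fl fr; rewrite /linfun2 linfun_val ?linfun_val // => k x y.
apply/lfunP=> z; rewrite !lfunE /= !lfunE /= !linfun_val //.
exact: fr.
Qed.

End BilinearMaps.

Section Flip.
Variables (F : fieldType) (U V W : vectType F).

Definition flip (B : 'Hom(U, 'Hom(V, W))) : 'Hom(V, 'Hom(U, W)) :=
  linfun2 (fun v u => B u v).

Lemma flipE B u v : flip B v u = B u v.
Proof.
rewrite /flip linfun2E // => x k y z; first by rewrite linearP !lfunE /= lfunE.
exact: linearP.
Qed.

End Flip.

Section Superspaces.
Variable F : fieldType.

Record superspace := Superspace {
  space :> vectType F;
  part : bool -> {vspace space}
}.

Definition graded (U : superspace) : Prop :=
  (part U false + part U true)%VS = fullv /\
  (part U false :&: part U true)%VS = 0%VS.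

Definition purely_even (U : superspace) : Prop := part U true = 0%VS.

Definition hcomp (U : superspace) (a : bool) : 'End(U) :=
  daddv_pi (part U a) (part U (~~ a)).

Definition even_map (U V : superspace) (phi : U -> V) : Prop :=
  forall a x, x \in part U a -> phi x \in part V a.

Definition even_iso (U V : superspace) (phi : 'Hom(U, V)) : Prop :=
  bijective phi /\ even_map phi.

Definition dual_superspace (M : superspace) : superspace :=
  @Superspace 'Hom(M, F^o)
    (fun a => lker (linfun (fun f : 'Hom(M, F^o) =>
                              (f \o projv (part M (~~ a)))%VF))).

Definition end_superspace (U : superspace) : superspace :=
  @Superspace 'End(U)
    (fun a => (\bigcap_(c : bool) lker (linfun (fun p : 'End(U) =>
       ((\1 - projv (part U (a (+) c))) \o p \o projv (part U c))%VF)))%VS).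

Definition prod_superspace (U V : superspace) : superspace :=
  @Superspace (U * V)%type
    (fun a => (linfun (fun p : U * V => p.1) @^-1: part U a :&:
               linfun (fun p : U * V => p.2) @^-1: part V a)%VS).

Definition sub_superspace (U : superspace) (S : {vspace U}) : superspace :=
  @Superspace (subvs_of S)
    (fun a => (linfun (@vsval _ _ S) @^-1: part U a)%VS).

Lemma mem_dual_part (M : superspace) a f :
  f \in part (dual_superspace M) a <->
  forall v, v \in part M (~~ a) -> f v = 0.
Proof.
have E : linfun (fun f : 'Hom(M, F^o) => (f \o projv (part M (~~ a)))%VF) f
         = (f \o projv (part M (~~ a)))%VF.
  by rewrite linfun_val // => k x y; rewrite comp_lfunDl -comp_lfunZl.
rewrite memv_ker E; split=> [/eqP/lfunP f0 v vM|f0].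
  by have := f0 v; rewrite comp_lfunE projv_id // lfunE.
by apply/eqP/lfunP=> v; rewrite comp_lfunE lfunE f0 ?memv_proj.
Qed.

Lemma mem_end_part (U : superspace) a p :
  p \in part (end_superspace U) a <->
  forall c x, x \in part U c -> p x \in part U (a (+) c).
Proof.
have E c : linfun (fun p : 'End(U) => ((\1 - projv (part U (a (+) c)))
            \o p \o projv (part U c))%VF) p
         = ((\1 - projv (part U (a (+) c))) \o p \o projv (part U c))%VF.
  rewrite linfun_val // => k x y.
  by rewrite comp_lfunDr -comp_lfunZr comp_lfunDl -comp_lfunZl.
split=> [|H].
  rewrite memvE => /subv_bigcapP H c x xc; have := H c isT.
  rewrite -memvE memv_ker E => /eqP/lfunP/(_ x).
  rewrite !comp_lfunE projv_id // !lfunE /= opp_lfunE id_lfunE => /subr0_eq ->.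
  exact: memv_proj.
rewrite memvE; apply/subv_bigcapP => c _; rewrite -memvE memv_ker E.
apply/eqP/lfunP=> x; rewrite !comp_lfunE !lfunE /= opp_lfunE id_lfunE.
by rewrite [projv _ (p _)]projv_id ?subrr // H ?memv_proj.
Qed.

Lemma mem_prod_part (U V : superspace) a p :
  (p \in part (prod_superspace U V) a) =
  (p.1 \in part U a) && (p.2 \in part V a).
Proof. by rewrite memv_cap -!memv_preim !linfun_val // => k. Qed.

Lemma mem_sub_part (U : superspace) (S : {vspace U}) a p :
  (p \in part (sub_superspace S) a) = (vsval p \in part U a).
Proof. by rewrite -memv_preim linfun_val // => k x y; rewrite linearP. Qed.

End Superspaces.

Section Objects.
Variable F : fieldType.

Record lsm := Lsm {
  alg : superspace F;
  smod : superspace F;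
  br : 'Hom(alg, 'End(alg));
  act : 'Hom(alg, 'End(smod));
  bform : 'Hom(alg, 'Hom(alg, F^o))
}.

Record superpair := Superpair {
  Vm : superspace F;
  Vp : superspace F;
  Dm : 'Hom(Vm, 'Hom(Vp, 'End(Vm)));
  Dp : 'Hom(Vp, 'Hom(Vm, 'End(Vp)));
  pform : 'Hom(Vm, 'Hom(Vp, F^o))
}.

Definition nondegenerate (U V : vectType F) (b : 'Hom(U, 'Hom(V, F^o))) : Prop :=
  (forall x, (forall y, b x y = 0) -> x = 0) /\
  (forall y, (forall x, b x y = 0) -> y = 0).

Definition homogeneous_form (U V : superspace F) (b : 'Hom(U, 'Hom(V, F^o))) :
    Prop :=
  forall a c x y, x \in part U a -> y \in part V c -> a != c -> b x y = 0.

Definition is_lie_superalgebra (L : superspace F) (br : 'Hom(L, 'End(L))) :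
    Prop :=
  [/\ graded L,
      forall a c x y, x \in part L a -> y \in part L c ->
        br x y \in part L (a (+) c),
      forall a c x y, x \in part L a -> y \in part L c ->
        br x y = - (eta F a c *: br y x)
    & forall a c d x y z,
        x \in part L a -> y \in part L c -> z \in part L d ->
        br x (br y z) = br (br x y) z + eta F a c *: br y (br x z)].

Definition is_supermodule (L : superspace F) (br : 'Hom(L, 'End(L)))
    (M : superspace F) (act : 'Hom(L, 'End(M))) : Prop :=
  [/\ graded M,
      forall a c x v, x \in part L a -> v \in part M c ->
        act x v \in part M (a (+) c)
    & forall a c x y v, x \in part L a -> y \in part L c ->
        act (br x y) v = act x (act y v) - eta F a c *: act y (act x v)].

Definition FLSM (X : lsm) : Prop :=
  [/\ is_lie_superalgebra (br X),
      is_supermodule (br X) (act X) /\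
      (forall x, (forall v, act X x v = 0) -> x = 0)
    & [/\ nondegenerate (bform X),
          homogeneous_form (bform X),
          forall x y z, bform X (br X x y) z = bform X x (br X y z)
        & forall a c x y, x \in part (alg X) a -> y \in part (alg X) c ->
            bform X x y = eta F a c * bform X y x]].

Definition FLM (X : lsm) : Prop :=
  [/\ FLSM X, purely_even (alg X) & purely_even (smod X)].

Definition lsm_iso (X Y : lsm) : Prop :=
  exists phi0 : 'Hom(alg X, alg Y), exists phip : 'Hom(smod X, smod Y),
  [/\ even_iso phi0 /\ even_iso phip,
      forall x y, phi0 (br X x y) = br Y (phi0 x) (phi0 y),
      forall x v, phip (act X x v) = act Y (phi0 x) (phip v)
    & forall x y, bform Y (phi0 x) (phi0 y) = bform X x y].

(* One half (one value of sigma) of the axioms of a generalized Jordan        *)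
(* superpair, with U = V^sigma and W = V^(-sigma).                            *)
Definition gjsp_axioms (U W : superspace F)
    (D : 'Hom(U, 'Hom(W, 'End(U)))) (D' : 'Hom(W, 'Hom(U, 'End(W)))) : Prop :=
  [/\ graded U,
      forall a c d x y z,
        x \in part U a -> y \in part W c -> z \in part U d ->
        D x y z \in part U (a (+) c (+) d)
    & forall a c d e x y z w,
        x \in part U a -> y \in part W c -> z \in part U d -> w \in part W e ->
        (D x y \o D z w - eta F (a (+) c) (d (+) e) *: (D z w \o D x y))%VF
        = D (D x y z) w - eta3 F a c d *: D z (D' y x w)].

Definition GJSP (V : superpair) : Prop :=
  [/\ gjsp_axioms (Dm V) (Dp V), gjsp_axioms (Dp V) (Dm V),
      nondegenerate (pform V) /\ homogeneous_form (pform V),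
      forall a c d e x y z w,
        x \in part (Vm V) a -> y \in part (Vp V) c ->
        z \in part (Vm V) d -> w \in part (Vp V) e ->
        pform V (Dm V x y z) w = eta3 F a c d * pform V z (Dp V y x w)
    & forall a c d e x y z w,
        x \in part (Vm V) a -> y \in part (Vp V) c ->
        z \in part (Vm V) d -> w \in part (Vp V) e ->
        pform V (Dm V x y z) w
          = eta F (a (+) c) (d (+) e) * pform V (Dm V z w x) y /\
        pform V x (Dp V y z w)
          = eta F (a (+) c) (d (+) e) * pform V z (Dp V w x y)].

Definition GJP (V : superpair) : Prop :=
  [/\ GJSP V, purely_even (Vm V) & purely_even (Vp V)].

Definition superpair_iso (V W : superpair) : Prop :=
  exists phim : 'Hom(Vm V, Vm W), exists phip : 'Hom(Vp V, Vp W),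
  [/\ even_iso phim /\ even_iso phip,
      forall x y z, phim (Dm V x y z) = Dm W (phim x) (phip y) (phim z),
      forall x y z, phip (Dp V x y z) = Dp W (phip x) (phim y) (phip z)
    & forall x y, pform W (phim x) (phip y) = pform V x y].

End Objects.

Section DecompositionLemmas.
Variable F : fieldType.
Implicit Type U : superspace F.

Lemma hcomp_mem U a x : hcomp U a x \in part U a.
Proof. exact: memv_pi. Qed.

Lemma hcomp_sum U x : graded U -> x = hcomp U false x + hcomp U true x.
Proof.
case=> UT U0; have xU : x \in (part U false + part U true)%VS.
  by rewrite UT memvf.
by rewrite /hcomp /= daddv_pi_add.
Qed.

Lemma hcomp_id_direct U a c x :
  (part U false :&: part U true)%VS = 0%VS -> x \in part U a ->
  hcomp U c x = if c == a then x else 0.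
Proof.
move=> U0 xa.
have U0c b : (part U b :&: part U (~~ b) = 0)%VS.
  by case: b => //=; rewrite capvC.
have idx b : x \in part U b -> hcomp U b x = x by move=> xb; apply: daddv_pi_id.
case: eqVneq => [->|neq]; first exact: idx.
have sumx : hcomp U false x + hcomp U true x = x.
  apply: daddv_pi_add => //; apply: subvP xa.
  by case: (a); rewrite ?addvSr ?addvSl.
move: neq (idx a xa) sumx; case: a {xa}; case: c => // _ ->.
  by rewrite -[RHS]add0r => /addIr.
by rewrite -[RHS]addr0 => /addrI.
Qed.

Lemma hcomp_id U a c x : graded U -> x \in part U a ->
  hcomp U c x = if c == a then x else 0.
Proof. by case=> _; apply: hcomp_id_direct. Qed.

Lemma graded_dual (M : superspace F) : graded M -> graded (dual_superspace M).
Proof.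
move=> gM; split; apply/eqP.
  rewrite eqEsubv subvf; apply/subvP=> f _.
  have -> : f = (f \o hcomp M false)%VF + (f \o hcomp M true)%VF.
    apply/lfunP=> v; rewrite lfunE /= !comp_lfunE -linearD.
    by rewrite -hcomp_sum.
  apply: memv_add; apply/mem_dual_part => v vM;
    by rewrite comp_lfunE (hcomp_id _ gM vM) linear0.
rewrite -subv0; apply/subvP=> f; rewrite memv_cap memv0.
move=> /andP[/mem_dual_part f0 /mem_dual_part f1].
apply/eqP/lfunP=> v; rewrite (hcomp_sum v gM) linearD lfunE /=.
by rewrite f1 ?f0 ?addr0 ?hcomp_mem.
Qed.

End DecompositionLemmas.

Section DualModule.
Variables (F : fieldType) (L M : superspace F) (act : 'Hom(L, 'End(M))).

Local Notation M' := (dual_superspace M).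

Definition dual_act_fun (x : L) (f : M') : M' :=
  - \sum_(a : bool) \sum_(c : bool)
      eta F a c *: (hcomp M' c f \o act (hcomp L a x))%VF.

Definition dual_act : 'Hom(L, 'End(M')) := linfun2 dual_act_fun.

Lemma dual_actE x f : dual_act x f = dual_act_fun x f.
Proof.
apply: linfun2E => [{}x k f1 f2|{}f k x1 x2]; rewrite /dual_act_fun;
  rewrite scalerN -opprD scaler_sumr -big_split; congr (- _);
  apply: eq_bigr => a _ /=; rewrite scaler_sumr -big_split /=;
  apply: eq_bigr => c _; apply/lfunP => v; do !rewrite ?linearP ?lfunE /=;
  rewrite ?linearP ?scalerDr !scalerA [k * _]mulrC //.
Qed.

Lemma dual_act_homogE a c x f v : graded L -> graded M ->
  x \in part L a -> f \in part M' c ->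
  dual_act x f v = - (eta F a c * f (act x v)).
Proof.
move=> gL /graded_dual gM xa fc; rewrite dual_actE /dual_act_fun !big_bool.
rewrite !(hcomp_id _ gL xa) !(hcomp_id _ gM fc).
by case: a {xa}; case: c {fc};
  rewrite /= !linear0 ?comp_lfun0l ?comp_lfun0r ?scaler0 ?addr0 ?add0r
          !lfunE /= ?lfunE /= ?lfunE.
Qed.

End DualModule.

Section Faulkner.
Variables (F : fieldType) (X : lsm F).

Local Notation L := (alg X).
Local Notation M := (smod X).
Local Notation M' := (dual_superspace M).

(* <v, f> = eta_{f,v} f(v) *)
Definition pair_vf (v : M) (f : M') : F :=
  \sum_(a : bool) \sum_(c : bool)
    eta F a c * (hcomp M' c f) (hcomp M a v).

(* The element l such that b(x, l) = h(x) for all x. *)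
Definition form_repr (h : 'Hom(L, F^o)) : L := ((flip (bform X))^-1)%VF h.

Definition br_fv (f : M') (v : M) : L :=
  form_repr (linfun (fun x => dual_act (act X) x f v)).

Definition br_vf (v : M) (f : M') : L :=
  form_repr (linfun (fun x => pair_vf (act X x v) f : F^o)).

Definition faulkner : superpair F :=
  @Superpair F M' M
    (linfun2 (fun f v => dual_act (act X) (br_fv f v)))
    (linfun2 (fun v f => act X (br_vf v f)))
    (linfun2 (fun (f : M') (v : M) => f v)).

Lemma form_reprP (h : 'Hom(L, F^o)) (l : L) : nondegenerate (bform X) ->
  (forall x, bform X x l = h x) <-> l = form_repr h.
Proof.
move=> [_ nd].
have k0 : lker (flip (bform X)) == 0%VS.
  apply/lker0P => y z /lfunP e; apply/eqP; rewrite -subr_eq0; apply/eqP/nd => x.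
  by rewrite linearB /=; have := e x; rewrite !flipE => ->; rewrite subrr.
have : limg (flip (bform X)) == fullv.
  rewrite eqEdim subvf /= limg_dim_eq ?capfv ?(eqP k0) //.
  by rewrite !dimvf /dim /= muln1.
move=> /eqP lf; have hl : h \in limg (flip (bform X)) by rewrite lf memvf.
rewrite /form_repr; split=> [e|-> x].
  rewrite -[LHS](lker0_lfunK k0); congr (_ _); apply/lfunP => x.
  by rewrite flipE e.
by rewrite -flipE limg_lfunVK.
Qed.

Lemma pair_vf_linl f k u v :
  pair_vf (k *: u + v) f = k * pair_vf u f + pair_vf v f.
Proof.
rewrite /pair_vf mulr_sumr -big_split; apply: eq_bigr => a _ /=.
rewrite mulr_sumr -big_split; apply: eq_bigr => c _ /=.
by rewrite !linearP /= mulrDr mulrCA.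
Qed.

Lemma pair_vf_linr v k f g :
  pair_vf v (k *: f + g) = k * pair_vf v f + pair_vf v g.
Proof.
rewrite /pair_vf mulr_sumr -big_split; apply: eq_bigr => a _ /=.
rewrite mulr_sumr -big_split; apply: eq_bigr => c _ /=.
by rewrite !linearP /= !lfunE /= lfunE /= mulrDr mulrCA.
Qed.

Lemma pair_vfE a c v f : graded M -> v \in part M a -> f \in part M' c ->
  pair_vf v f = eta F a c * f v.
Proof.
move=> gM va fc; rewrite /pair_vf !big_bool.
rewrite !(hcomp_id _ gM va) !(hcomp_id _ (graded_dual gM) fc).
by case: a {va}; case: c {fc};
  rewrite /= ?linear0 ?lfunE /= ?mulr0 ?addr0 ?add0r.
Qed.

Lemma br_fvP f v l : nondegenerate (bform X) ->
  (forall x, bform X x l = dual_act (act X) x f v) <-> l = br_fv f v.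
Proof.
move=> nd; apply: (iff_trans _ (form_reprP _ _ nd)).
have E x : linfun (fun x => dual_act (act X) x f v) x = dual_act (act X) x f v.
  rewrite linfun_val // => k y z.
  by rewrite linearP /= lfunE /= lfunE /= lfunE /= lfunE.
by split=> e x; rewrite e E.
Qed.

Lemma br_fvE x f v : nondegenerate (bform X) ->
  bform X x (br_fv f v) = dual_act (act X) x f v.
Proof. by move=> nd; move: x; apply/br_fvP. Qed.

Lemma br_vfP v f l : nondegenerate (bform X) ->
  (forall x, bform X x l = pair_vf (act X x v) f) <-> l = br_vf v f.
Proof.
move=> nd; apply: (iff_trans _ (form_reprP _ _ nd)).
have E x : linfun (fun x => pair_vf (act X x v) f : F^o) x
           = pair_vf (act X x v) f.
  rewrite linfun_val // => k y z.
  by rewrite linearP /= !lfunE /= lfunE /= pair_vf_linl.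
by split=> e x; rewrite e E.
Qed.

Lemma br_vfE x v f : nondegenerate (bform X) ->
  bform X x (br_vf v f) = pair_vf (act X x v) f.
Proof. by move=> nd; move: x; apply/br_vfP. Qed.

Lemma faulkner_DmE f v : nondegenerate (bform X) ->
  Dm faulkner f v = dual_act (act X) (br_fv f v).
Proof.
move=> nd; apply: linfun2E => [{}f k u w|{}v k f1 f2]; rewrite -linearP;
  congr (dual_act _ _); apply/esym/br_fvP => // x; rewrite !linearP /=.
  by rewrite !br_fvE.
by rewrite !lfunE /= lfunE /= !br_fvE.
Qed.

Lemma faulkner_DpE v f : nondegenerate (bform X) ->
  Dp faulkner v f = act X (br_vf v f).
Proof.
move=> nd; apply: linfun2E => [{}v k f1 f2|{}f k u w]; rewrite -linearP;
  congr (act X _); apply/esym/br_vfP => // x; rewrite !linearP /=.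
  by rewrite pair_vf_linr !br_vfE.
by rewrite pair_vf_linl !br_vfE.
Qed.

Lemma faulkner_formE f v : pform faulkner f v = f v.
Proof.
apply: linfun2E => [{}f k u w|{}v k f1 f2]; first exact: linearP.
by rewrite !lfunE /= lfunE.
Qed.

End Faulkner.

Section Supercommutator.
Variables (F : fieldType) (U : superspace F) (mul : U -> U -> U).

Definition supercomm (p q : U) : U :=
  \sum_(a : bool) \sum_(c : bool)
    (mul (hcomp U a p) (hcomp U c q)
     - eta F a c *: mul (hcomp U c q) (hcomp U a p)).

Hypothesis mul_linl : forall q, linear (mul^~ q).
Hypothesis mul_linr : forall p, linear (mul p).

Lemma supercomm_linl q : linear (supercomm^~ q).
Proof.
move=> k p1 p2; rewrite /supercomm scaler_sumr -big_split.
apply: eq_bigr => a _ /=; rewrite scaler_sumr -big_split.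
apply: eq_bigr => c _ /=; rewrite linearP mul_linl mul_linr.
rewrite scalerBr addrACA -opprD; congr (_ - _).
by rewrite scalerDr !scalerA mulrC.
Qed.

Lemma supercomm_linr p : linear (supercomm p).
Proof.
move=> k q1 q2; rewrite /supercomm scaler_sumr -big_split.
apply: eq_bigr => a _ /=; rewrite scaler_sumr -big_split.
apply: eq_bigr => c _ /=; rewrite linearP mul_linl mul_linr.
rewrite scalerBr addrACA -opprD; congr (_ - _).
by rewrite scalerDr !scalerA mulrC.
Qed.

Lemma supercomm_homogE a c p q :
  (part U false :&: part U true)%VS = 0%VS ->
  p \in part U a -> q \in part U c ->
  supercomm p q = mul p q - eta F a c *: mul q p.
Proof.
move=> U0 pa qc.
have z1 r : mul 0 r = 0.
  by have := mul_linl r (-1) 0 0; rewrite !scaleN1r !addNr.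
have z2 r : mul r 0 = 0.
  by have := mul_linr r (-1) 0 0; rewrite !scaleN1r !addNr.
rewrite /supercomm !big_bool !(hcomp_id_direct _ U0 pa).
rewrite !(hcomp_id_direct _ U0 qc).
by case: a {pa}; case: c {qc};
  rewrite /= ?z1 ?z2 ?scaler0 ?subr0 ?addr0 ?add0r.
Qed.

End Supercommutator.

Section InnerStructure.
Variables (F : fieldType) (V : superpair F).

Local Notation E :=
  (prod_superspace (end_superspace (Vm V)) (end_superspace (Vp V))).

Definition nu (f : Vm V) (v : Vp V) : E :=
  (Dm V f v,
   - \sum_(a : bool) \sum_(c : bool)
       eta F a c *: Dp V (hcomp (Vp V) c v) (hcomp (Vm V) a f)).

Definition instr : {vspace E} :=
  <<[seq nu f v | f <- vbasis {:Vm V}, v <- vbasis {:Vp V}]>>%VS.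

(* The product of End(V^- (+) V^+) on its block diagonal part. *)
Definition emul (p q : E) : E := ((p.1 \o q.1)%VF, (p.2 \o q.2)%VF).

Definition sbr (p q : E) : E := supercomm emul p q.

Local Notation L := (sub_superspace instr).

(* [vsproj] is harmless on a generalized Jordan superpair: see [instr_brE].   *)
Definition instr_br : 'Hom(L, 'End(L)) :=
  linfun2 (fun p q : L => vsproj instr (sbr (vsval p) (vsval q)) : L).

Definition instr_act : 'Hom(L, 'End(Vp V)) := linfun (fun p : L => (vsval p).2).

Definition is_instr_form (b : 'Hom(L, 'Hom(L, F^o))) : Prop :=
  forall (p q : L) f v g w, vsval p = nu f v -> vsval q = nu g w ->
    b p q = pform V (Dm V f v g) w.

Definition instr_lsm (b : 'Hom(L, 'Hom(L, F^o))) : lsm F :=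
  @Lsm F L (Vp V) instr_br instr_act b.

Lemma nu_linl v : linear (nu^~ v).
Proof.
move=> k f g; congr (_, _); first by rewrite linearP !lfunE /= lfunE.
rewrite /= scalerN -opprD scaler_sumr -big_split; congr (- _).
apply: eq_bigr => a _ /=; rewrite scaler_sumr -big_split /=.
apply: eq_bigr => c _; rewrite linearP /= linearP scalerDr !scalerA.
by rewrite mulrC.
Qed.

Lemma nu_linr f : linear (nu f).
Proof.
move=> k v w; congr (_, _); first exact: linearP.
rewrite /= scalerN -opprD scaler_sumr -big_split; congr (- _).
apply: eq_bigr => a _ /=; rewrite scaler_sumr -big_split /=.
apply: eq_bigr => c _; rewrite linearP linearP /= lfunE /= lfunE /=.
by rewrite scalerDr !scalerA mulrC.
Qed.

Lemma nu_homogE a c f v : graded (Vm V) -> graded (Vp V) ->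
  f \in part (Vm V) a -> v \in part (Vp V) c ->
  nu f v = (Dm V f v, - (eta F a c *: Dp V v f)).
Proof.
move=> gm gp fa vc; congr (_, - _); rewrite !big_bool.
rewrite !(hcomp_id _ gm fa) !(hcomp_id _ gp vc).
by case: a {fa}; case: c {vc};
  rewrite /= ?linear0 ?lfunE /= ?scaler0 ?addr0 ?add0r.
Qed.

Lemma memv_nu f v : nu f v \in instr.
Proof.
have Ef : linfun (nu^~ v) f = nu f v by rewrite linfun_val //; apply: nu_linl.
rewrite -Ef (coord_vbasis (memvf f)) linear_sum; apply: memv_suml => i _.
rewrite linearZ memvZ //= linfun_val; last exact: nu_linl.
set g := _`_i.
have Ev : linfun (nu g) v = nu g v by rewrite linfun_val //; apply: nu_linr.
rewrite -Ev (coord_vbasis (memvf v)) linear_sum; apply: memv_suml => j _.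
rewrite linearZ memvZ //= linfun_val; last exact: nu_linr.
by apply/memv_span/allpairs_f; rewrite mem_nth ?size_tuple.
Qed.

Lemma instr_sub (S : {vspace E}) :
  (forall f v, nu f v \in S) -> (instr <= S)%VS.
Proof.
by move=> nuS; apply/span_subvP => _ /allpairsP[[f v] [_ _ ->]]; apply: nuS.
Qed.

Lemma emul_linl q : linear (emul^~ q).
Proof.
by move=> k p1 p2; congr (_, _); rewrite /= comp_lfunDl -comp_lfunZl.
Qed.

Lemma emul_linr p : linear (emul p).
Proof.
by move=> k q1 q2; congr (_, _); rewrite /= comp_lfunDr -comp_lfunZr.
Qed.

Lemma end_direct (U : superspace F) : graded U ->
  (part (end_superspace U) false :&: part (end_superspace U) true)%VS = 0%VS.
Proof.
move=> gU; have [_ U0] := gU; apply/eqP; rewrite -subv0; apply/subvP=> p.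
rewrite memv_cap memv0 => /andP[/mem_end_part p0 /mem_end_part p1].
have p00 b x : x \in part U b -> p x = 0.
  move=> xb; apply/eqP; rewrite -memv0 -U0 memv_cap.
  by have := p0 _ _ xb; have := p1 _ _ xb; case: b {xb} => /= -> ->.
apply/eqP/lfunP=> x; rewrite (hcomp_sum x gU) linearD lfunE /=.
by rewrite !(p00 _ _ (hcomp_mem _ _)) addr0.
Qed.

Lemma sbr_linl q : linear (sbr^~ q).
Proof. by apply: supercomm_linl; [exact: emul_linl | exact: emul_linr]. Qed.

Lemma sbr_linr p : linear (sbr p).
Proof. by apply: supercomm_linr; [exact: emul_linl | exact: emul_linr]. Qed.

Lemma instr_ambient_direct : graded (Vm V) -> graded (Vp V) ->
  (part E false :&: part E true)%VS = 0%VS.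
Proof.
move=> gm gp; apply/eqP; rewrite -subv0; apply/subvP=> p.
rewrite memv_cap memv0 !mem_prod_part => /andP[/andP[a0 b0] /andP[a1 b1]].
have /eqP p1 : p.1 == 0 by rewrite -memv0 -(end_direct gm) memv_cap a0.
have /eqP p2 : p.2 == 0 by rewrite -memv0 -(end_direct gp) memv_cap b0.
by apply/eqP; rewrite [p]surjective_pairing p1 p2.
Qed.

Lemma sbr_homogE a c p q : graded (Vm V) -> graded (Vp V) ->
  p \in part E a -> q \in part E c ->
  sbr p q = emul p q - eta F a c *: emul q p.
Proof.
move=> gm gp; apply: supercomm_homogE; first exact: emul_linl.
  exact: emul_linr.
exact: instr_ambient_direct.
Qed.

Lemma nu_part a c f v : GJSP V ->
  f \in part (Vm V) a -> v \in part (Vp V) c -> nu f v \in part E (a (+) c).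
Proof.
case=> -[gm Gm _] [gp Gp _] _ _ _ fa vc.
rewrite (nu_homogE gm gp fa vc) mem_prod_part; apply/andP; split.
  by apply/mem_end_part => d x xd; apply: Gm.
rewrite /= rpredN rpredZ //; apply/mem_end_part => d x xd.
by rewrite [a (+) c]addbC; apply: Gp.
Qed.

Lemma sbr_nu a c d e f v g w : GJSP V ->
  f \in part (Vm V) a -> v \in part (Vp V) c ->
  g \in part (Vm V) d -> w \in part (Vp V) e ->
  sbr (nu f v) (nu g w) =
    nu (Dm V f v g) w - eta3 F a c d *: nu g (Dp V v f w).
Proof.
move=> GV fa vc gd we; have [[gm Gm Im] [gp Gp Ip] _ _ _] := GV.
rewrite (sbr_homogE gm gp (nu_part GV fa vc) (nu_part GV gd we)).
rewrite (nu_homogE gm gp fa vc) (nu_homogE gm gp gd we).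
rewrite (nu_homogE gm gp (Gm _ _ _ _ _ _ fa vc gd) we).
rewrite (nu_homogE gm gp gd (Gp _ _ _ _ _ _ vc fa we)).
congr (_, _) => /=; first exact: Im fa vc gd we.
rewrite !(comp_lfunNl, comp_lfunNr) !opprK -!(comp_lfunZl, comp_lfunZr).
have {Ip} := Ip _ _ _ _ _ _ _ _ vc fa we gd.
set r := Dp V (Dp V v f w) g; set t := Dp V w (Dm V f v g) => H.
pose sgn := (mul1r, mulr1, mulN1r, mulrN1, opprK).
transitivity ((eta F a c * eta F d e) *: (r - eta3 F c a e *: t)).
  rewrite -H scalerBr !scalerA; congr (_ - _ *: _).
  by case: (a); case: (c); case: (d); case: (e); rewrite /eta /= ?sgn.
rewrite scalerBr !scalerA scalerN opprK scalerA [RHS]addrC.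
congr (_ *: _ - _ *: _);
  by case: (a); case: (c); case: (d); case: (e); rewrite /eta3 /eta /= ?sgn.
Qed.

Lemma instr_closed p q : GJSP V -> p \in instr -> q \in instr ->
  sbr p q \in instr.
Proof.
move=> GV pI qI; have [[gm _ _] [gp _ _] _ _ _] := GV.
have homog a c d e f v g w :
    f \in part (Vm V) a -> v \in part (Vp V) c ->
    g \in part (Vm V) d -> w \in part (Vp V) e ->
  sbr (nu f v) (nu g w) \in instr.
  by move=> *; rewrite (sbr_nu GV (a:=a) (c:=c) (d:=d) (e:=e)) // rpredB ?rpredZ ?memv_nu.
have Ll r x : linfun (sbr^~ r) x = sbr x r.
  by rewrite linfun_val //; apply: sbr_linl.
have Lr r x : linfun (sbr r) x = sbr r x.
  by rewrite linfun_val //; apply: sbr_linr.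
have nl f v : nu f v =
  \sum_(a : bool) \sum_(c : bool) nu (hcomp (Vm V) a f) (hcomp (Vp V) c v).
  have El y x : linfun (nu^~ y) x = nu x y by rewrite linfun_val //; apply: nu_linl.
  have Er x y : linfun (nu x) y = nu x y by rewrite linfun_val //; apply: nu_linr.
  rewrite {1}(hcomp_sum f gm) {1}(hcomp_sum v gp) !big_bool.
  have Dl x1 x2 y : nu (x1 + x2) y = nu x1 y + nu x2 y.
    by rewrite -!El linearD.
  have Dr x y1 y2 : nu x (y1 + y2) = nu x y1 + nu x y2.
    by rewrite -!Er linearD.
  by rewrite Dl !Dr [RHS]addrC; congr (_ + _); rewrite [RHS]addrC.
have nn f v g w : sbr (nu f v) (nu g w) \in instr.
  rewrite (nl f v) -Ll linear_sum; apply: memv_suml => a _.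
  rewrite linear_sum; apply: memv_suml => c _; rewrite /= Ll.
  rewrite (nl g w) -Lr linear_sum; apply: memv_suml => d _.
  rewrite linear_sum; apply: memv_suml => e _; rewrite /= Lr.
  by apply: homog; apply: hcomp_mem.
have ln f v : sbr (nu f v) q \in instr.
  rewrite -Lr memv_preim; apply: subvP q qI; apply: instr_sub => g w.
  by rewrite -memv_preim Lr.
rewrite -Ll memv_preim; apply: subvP p pI; apply: instr_sub => f v.
by rewrite -memv_preim Ll.
Qed.

Lemma instr_brE (p q : L) : GJSP V ->
  vsval (instr_br p q) = sbr (vsval p) (vsval q).
Proof.
move=> GV; rewrite linfun2E.
- by rewrite vsprojK // instr_closed ?subvsP.
- move=> x k y z; rewrite -[RHS]linearP; apply: (congr1 (vsproj instr)).
  by rewrite linearP; apply: sbr_linr.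
move=> x k y z; rewrite -[RHS]linearP; apply: (congr1 (vsproj instr)).
by rewrite linearP; apply: sbr_linl.
Qed.

Lemma instr_actE (p : L) v : instr_act p v = (vsval p).2 v.
Proof. by rewrite linfun_val // => k x y; rewrite linearP. Qed.

End InnerStructure.

Section Correspondence.

(* [f] and [g] are relations rather than functions so that an output may be   *)
(* specified by a characteristic property.                                    *)
Definition iso_class_bijection (A B : Type)
    (PA : A -> Prop) (isoA : A -> A -> Prop)
    (PB : B -> Prop) (isoB : B -> B -> Prop)
    (f : A -> B -> Prop) (g : B -> A -> Prop) : Prop :=
  [/\ [/\ forall X, PA X -> exists Y, f X Y,
          forall X Y, PA X -> f X Y -> PB Y
        & forall X X' Y Y', PA X -> PA X' -> f X Y -> f X' Y' ->
            isoA X X' -> isoB Y Y'],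
      [/\ forall Y, PB Y -> exists X, g Y X,
          forall Y X, PB Y -> g Y X -> PA X
        & forall Y Y' X X', PB Y -> PB Y' -> g Y X -> g Y' X' ->
            isoB Y Y' -> isoA X X'],
      forall X Y X', PA X -> f X Y -> g Y X' -> isoA X' X
    & forall Y X Y', PB Y -> g Y X -> f X Y' -> isoB Y' Y].

Variable F : fieldType.

Definition faulkner_of (X : lsm F) (V : superpair F) : Prop := V = faulkner X.

Definition instr_of (V : superpair F) (X : lsm F) : Prop :=
  exists2 b, is_instr_form b & X = @instr_lsm F V b.

Definition associated (X : lsm F) (V : superpair F) : Prop :=
  superpair_iso (faulkner X) V.

End Correspondence.

(* Commutative unital F-algebras, the zero algebra included. *)
Record kalgebra (F : fieldType) := Kalgebra {
  kring :> comPzRingType;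
  kstr : {rmorphism F -> kring}
}.

Record khom (F : fieldType) (R S : kalgebra F) := Khom {
  kfun :> {rmorphism R -> S};
  kfun_str : forall c, kfun (kstr R c) = kstr S c
}.

(* U (x) R is R^(dim U), in the coordinates given by [vbasis {:U}]; [ext x]   *)
(* stands for x (x) 1, and R-linear maps are matrices acting on row vectors.  *)
Section ScalarExtension.
Variables (F : fieldType) (R : kalgebra F).

Local Notation "U @R" := ('rV[R]_(\dim {:U})) (at level 2, format "U @R").

Definition ebasis (U : vectType F) (i : 'I_(\dim {:U})) : U :=
  (vbasis {:U})`_i.

Definition ext (U : vectType F) (x : U) : U@R :=
  \row_i kstr R (coord (vbasis {:U}) i x).

Definition ext_part (U : superspace F) (a : bool) (u : U@R) : Prop :=
  exists c : 'I_(\dim (part U a)) -> R,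
    u = \sum_i c i *: ext (vbasis (part U a))`_i.

Definition ext_form (U V : vectType F) (b : 'Hom(U, 'Hom(V, F^o)))
    (u : U@R) (v : V@R) : R :=
  \sum_i \sum_j u 0 i * v 0 j * kstr R (b (ebasis i) (ebasis j)).

Definition ext_bilin (U V W : vectType F) (B : 'Hom(U, 'Hom(V, W)))
    (u : U@R) (v : V@R) : W@R :=
  \sum_i \sum_j (u 0 i * v 0 j) *: ext (B (ebasis i) (ebasis j)).

Definition ext_trilin (U V W Z : vectType F) (T : 'Hom(U, 'Hom(V, 'Hom(W, Z))))
    (u : U@R) (v : V@R) (w : W@R) : Z@R :=
  \sum_i \sum_j \sum_k (u 0 i * v 0 j * w 0 k) *:
    ext (T (ebasis i) (ebasis j) (ebasis k)).

Definition ext_even_iso (U : superspace F) (A : 'M[R]_(\dim {:U})) : Prop :=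
  (exists B, A *m B = 1%:M /\ B *m A = 1%:M) /\
  (forall a (u : U@R), ext_part a u -> ext_part a (u *m A)).

End ScalarExtension.

Section AutomorphismSchemes.
Variable F : fieldType.

(* Functors of points of subgroup schemes of GL_n x GL_m. *)
Definition mxfunctor (n m : nat) :=
  forall R : kalgebra F, 'M[R]_n * 'M[R]_m -> Prop.

(* Matrices act on row vectors, hence the reversed products. *)
Definition mxcomp n m (R : kalgebra F) (g h : 'M[R]_n * 'M[R]_m) :=
  (h.1 *m g.1, h.2 *m g.2).

Definition mxmap n m (R S : kalgebra F) (psi : khom R S)
    (g : 'M[R]_n * 'M[R]_m) : 'M[S]_n * 'M[S]_m :=
  (map_mx psi g.1, map_mx psi g.2).

(* Natural isomorphism of group-valued functors on commutative F-algebras,    *)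
(* i.e. an isomorphism of the affine group schemes they represent.            *)
Definition group_scheme_iso n m n' m'
    (P : mxfunctor n m) (Q : mxfunctor n' m') : Prop :=
  exists Theta : forall R : kalgebra F,
      'M[R]_n * 'M[R]_m -> 'M[R]_n' * 'M[R]_m',
  [/\ forall R g, P R g -> Q R (Theta R g),
      forall R g h, P R g -> P R h ->
        Theta R (mxcomp g h) = mxcomp (Theta R g) (Theta R h),
      forall R g h, P R g -> P R h -> Theta R g = Theta R h -> g = h,
      forall R g, Q R g -> exists2 h, P R h & Theta R h = g
    & forall R S (psi : khom R S) g, P R g ->
        Theta S (mxmap psi g) = mxmap psi (Theta R g)].

Definition Aut_lsm (X : lsm F) :
    mxfunctor (\dim {:alg X}) (\dim {:smod X}) :=
  fun R g =>
  let phi0 (x : 'rV[R]_(\dim {:alg X})) := x *m g.1 in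
  let phip (v : 'rV[R]_(\dim {:smod X})) := v *m g.2 in
  [/\ ext_even_iso g.1 /\ ext_even_iso g.2,
      forall x y, phi0 (ext_bilin (br X) x y)
                  = ext_bilin (br X) (phi0 x) (phi0 y),
      forall x v, phip (ext_bilin (act X) x v)
                  = ext_bilin (act X) (phi0 x) (phip v)
    & forall x y, ext_form (bform X) (phi0 x) (phi0 y)
                  = ext_form (bform X) x y].

Definition Aut_superpair (V : superpair F) :
    mxfunctor (\dim {:Vm V}) (\dim {:Vp V}) :=
  fun R g =>
  let phim (x : 'rV[R]_(\dim {:Vm V})) := x *m g.1 in
  let phip (v : 'rV[R]_(\dim {:Vp V})) := v *m g.2 in
  [/\ ext_even_iso g.1 /\ ext_even_iso g.2,
      forall x y z, phim (ext_trilin (Dm V) x y z)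
                    = ext_trilin (Dm V) (phim x) (phip y) (phim z),
      forall x y z, phip (ext_trilin (Dp V) x y z)
                    = ext_trilin (Dp V) (phip x) (phim y) (phip z)
    & forall f v, ext_form (pform V) (phim f) (phip v)
                  = ext_form (pform V) f v].

End AutomorphismSchemes.

Arguments Aut_lsm {F} X R g.
Arguments Aut_superpair {F} V R g.

(* Main.v *)
Require Import Defs.
From Stdlib Require Import ClassicalEpsilon.
From HB Require Import structures.
From mathcomp Require Import all_boot all_order all_algebra.
Set Implicit Arguments.
Unset Strict Implicit.
Unset Printing Implicit Defensive.
Import GRing.Theory.
Local Open Scope ring_scope.
Import Defs.

(** The Faulkner construction is inverted by passing to the action.

    Let $(L,M,b)$ be in FLSM. The bracket $[f,v]$ is dual to the action of $L$,
    so the axioms of the superpair $(M^*,M)$ are identities of $L$ and $M$ in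
    disguise: the superpair identity is equivariance of the bracket ([br_fvbr])
    and the symmetry of the pairing is that of $b$, because
    $\langle\{f,v,g\},w\rangle=b([f,v],[g,w])$.

    Since $M$ is faithful and $b$ nondegenerate, the elements $[v,f]$ span $L$
    ([vfbr_span]). As $[v,f]\cdot w=\{v,f,w\}$, the image of $L$ in the
    endomorphisms of $M$ is spanned by the inner operators of the superpair.
    Hence an isomorphism of superpairs $(\varphi^-,\varphi^+)$ conjugates one
    image into the other and lifts to exactly one isomorphism of the triples
    ([iso_superpair_faulkner]); conversely $(\varphi_0,\varphi^+)$ gives
    $\varphi^-$ as the contragredient of $\varphi^+$ ([iso_lsm_faulkner]).
    The construction is thus fully faithful on isomorphisms, and the argument
    works over every extension of scalars $R$. Over the ground field it says
    that two triples are isomorphic when their superpairs are; over all $R$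
    and for one triple it is the isomorphism of automorphism schemes.

    It remains to see that every superpair occurs. For $\mathcal V$ in GJSP
    the form $b$ on the inner structure superalgebra is well defined because,
    by supersymmetry, $\langle D_{f,v}g,w\rangle$ depends on $(g,w)$ only
    through $\nu(g,w)$ ([pair_tensor0]). Superinvariance gives both the
    faithfulness of $\mathcal V^+$ ([instr_skew]) and the invariance of $b$.
    The pairing identifies $\mathcal V^-$ with the dual of $\mathcal V^+$ and
    turns $[f,v]$ into $\nu(f,v)$ ([fvbr_instr]), so the Faulkner construction
    applied to the inner structure superalgebra returns $\mathcal V$
    ([faulkner_instr]). Full faithfulness makes this right inverse a two-sided
    one on isomorphism classes.

    Extension of scalars is handled in coordinates: identities over the ground
    field are multilinear, and those passing to $R$ involve the parities only
    through the projections on the homogeneous parts. *)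

(** * Extension of scalars *)

Section Ext.
Variables (F : fieldType) (R : kalgebra F).
Local Notation "U @R" := ('rV[R]_(\dim {:U})) (at level 2, format "U @R").
Implicit Types U V W Z : vectType F.

Lemma coord_ebasis U (i j : 'I_(\dim {:U})) :
  coord (vbasis {:U}) i (ebasis j) = (j == i)%:R.
Proof. by rewrite /ebasis coord_free // (basis_free (vbasisP _)). Qed.

Lemma ebasis_gen U (x : U) :
  x = \sum_i coord (vbasis {:U}) i x *: ebasis i.
Proof. by rewrite {1}(coord_vbasis (memvf x)). Qed.

Lemma extP U k (x y : U) :
  ext R (k *: x + y) = kstr R k *: ext R x + ext R y.
Proof. by apply/rowP=> i; rewrite !mxE linearP /= rmorphD rmorphM. Qed.

Lemma ext0 U : ext R (0 : U) = 0.
Proof. by apply/rowP=> i; rewrite !mxE linear0 rmorph0. Qed.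

Lemma extZ U k (x : U) : ext R (k *: x) = kstr R k *: ext R x.
Proof. by rewrite -[k *: x]addr0 extP ext0 addr0. Qed.

Lemma extD U (x y : U) : ext R (x + y) = ext R x + ext R y.
Proof. by rewrite -[x]scale1r extP rmorph1 !scale1r. Qed.

Lemma ext_sum U I (r : seq I) (P : pred I) (E : I -> U) :
  ext R (\sum_(i <- r | P i) E i) = \sum_(i <- r | P i) ext R (E i).
Proof. exact: (big_morph _ (@extD U) (@ext0 U)). Qed.

Lemma ext_ebasis U (i : 'I_(\dim {:U})) : ext R (ebasis i) = delta_mx 0 i.
Proof.
by apply/rowP=> j; rewrite !mxE coord_ebasis rmorph_nat eqxx /= eq_sym.
Qed.

Lemma ext_gen U (u : U@R) : u = \sum_i u 0 i *: ext R (ebasis i).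
Proof.
by rewrite {1}[u]row_sum_delta; apply: eq_bigr => i _; rewrite ext_ebasis.
Qed.

Lemma ext_basis_ind U (P : U@R -> Prop) : P 0 ->
  (forall k u v, P u -> P v -> P (k *: u + v)) ->
  (forall i, P (ext R (ebasis i : U))) -> forall u, P u.
Proof.
move=> P0 PD Pe u; rewrite [u]ext_gen.
by elim/big_rec: _ => [//|i v _ Pv]; apply: PD.
Qed.

(** The elements $x\otimes 1$ span $U\otimes R$. Applied to one variable after
    the other, this carries multilinear identities from the ground field
    to $R$. *)
Lemma ext_ind U (P : U@R -> Prop) :
  (forall k u v, P u -> P v -> P (k *: u + v)) ->
  (forall x, P (ext R x)) -> forall u, P u.
Proof.
by move=> PD Pe; apply: ext_basis_ind => //; rewrite -(ext0 U).
Qed.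

Lemma row_linP U W k (u v : U@R) (A : 'M[R]_(\dim {:U}, \dim {:W})) :
  (k *: u + v) *m A = k *: (u *m A) + v *m A.
Proof. by rewrite mulmxDl scalemxAl. Qed.

Lemma ext_form_linl U V (b : 'Hom(U, 'Hom(V, F^o))) (k : R) (u u' : U@R) v :
  ext_form b (k *: u + u') v = k * ext_form b u v + ext_form b u' v.
Proof.
rewrite /ext_form mulr_sumr -big_split; apply: eq_bigr => i _ /=.
rewrite mulr_sumr -big_split; apply: eq_bigr => j _ /=.
by rewrite !mxE !mulrDl !mulrA.
Qed.

Lemma ext_form_linr U V (b : 'Hom(U, 'Hom(V, F^o))) (k : R) u (v v' : V@R) :
  ext_form b u (k *: v + v') = k * ext_form b u v + ext_form b u v'.
Proof.
rewrite /ext_form mulr_sumr -big_split; apply: eq_bigr => i _ /=.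
rewrite mulr_sumr -big_split; apply: eq_bigr => j _ /=.
by rewrite !mxE mulrDr mulrDl mulrCA !mulrA.
Qed.

Lemma ext_form_ext U V (b : 'Hom(U, 'Hom(V, F^o))) x y :
  ext_form b (ext R x) (ext R y) = kstr R (b x y).
Proof.
rewrite {2}(ebasis_gen x) linear_sum /= sum_lfunE rmorph_sum.
apply: eq_bigr => i _; rewrite {2}(ebasis_gen y) linear_sum rmorph_sum.
apply: eq_bigr => j _ /=.
rewrite linearZ /= linearZ /= lfunE /= !mxE -!rmorphM; congr (kstr R _).
by rewrite ![_ *: _]mulrA [X in X * _]mulrC.
Qed.

Lemma ext_bilin_linl U V W (B : 'Hom(U, 'Hom(V, W))) (k : R) (u u' : U@R) v :
  ext_bilin B (k *: u + u') v = k *: ext_bilin B u v + ext_bilin B u' v.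
Proof.
rewrite /ext_bilin scaler_sumr -big_split; apply: eq_bigr => i _ /=.
rewrite scaler_sumr -big_split; apply: eq_bigr => j _ /=.
by rewrite !mxE mulrDl scalerDl scalerA mulrA.
Qed.

Lemma ext_bilin_linr U V W (B : 'Hom(U, 'Hom(V, W))) (k : R) u (v v' : V@R) :
  ext_bilin B u (k *: v + v') = k *: ext_bilin B u v + ext_bilin B u v'.
Proof.
rewrite /ext_bilin scaler_sumr -big_split; apply: eq_bigr => i _ /=.
rewrite scaler_sumr -big_split; apply: eq_bigr => j _ /=.
by rewrite !mxE mulrDr scalerDl scalerA mulrCA.
Qed.

Lemma ext_bilin0l U V W (B : 'Hom(U, 'Hom(V, W))) v :
  ext_bilin B (0 : U@R) v = 0.
Proof.
by have := ext_bilin_linl B (-1) 0 0 v; rewrite !scaleN1r !addNr.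
Qed.

Lemma ext_bilin_ext U V W (B : 'Hom(U, 'Hom(V, W))) x y :
  ext_bilin B (ext R x) (ext R y) = ext R (B x y).
Proof.
rewrite {2}(ebasis_gen x) linear_sum /= sum_lfunE ext_sum.
apply: eq_bigr => i _; rewrite {2}(ebasis_gen y) linear_sum ext_sum.
apply: eq_bigr => j _ /=.
by rewrite linearZ /= linearZ /= lfunE /= !mxE !extZ scalerA mulrC.
Qed.

Lemma ext_trilin_linl U V W Z (T : 'Hom(U, 'Hom(V, 'Hom(W, Z)))) (k : R)
    (u u' : U@R) v w :
  ext_trilin T (k *: u + u') v w
    = k *: ext_trilin T u v w + ext_trilin T u' v w.
Proof.
rewrite /ext_trilin scaler_sumr -big_split; apply: eq_bigr => i _ /=.
rewrite scaler_sumr -big_split; apply: eq_bigr => j _ /=.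
rewrite scaler_sumr -big_split; apply: eq_bigr => l _ /=.
by rewrite !mxE !mulrDl scalerDl scalerA !mulrA.
Qed.

Lemma ext_trilin_linm U V W Z (T : 'Hom(U, 'Hom(V, 'Hom(W, Z)))) (k : R)
    u (v v' : V@R) w :
  ext_trilin T u (k *: v + v') w
    = k *: ext_trilin T u v w + ext_trilin T u v' w.
Proof.
rewrite /ext_trilin scaler_sumr -big_split; apply: eq_bigr => i _ /=.
rewrite scaler_sumr -big_split; apply: eq_bigr => j _ /=.
rewrite scaler_sumr -big_split; apply: eq_bigr => l _ /=.
by rewrite !mxE mulrDr mulrDl scalerDl scalerA mulrCA !mulrA.
Qed.

Lemma ext_trilin_linr U V W Z (T : 'Hom(U, 'Hom(V, 'Hom(W, Z)))) (k : R)
    u v (w w' : W@R) :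
  ext_trilin T u v (k *: w + w')
    = k *: ext_trilin T u v w + ext_trilin T u v w'.
Proof.
rewrite /ext_trilin scaler_sumr -big_split; apply: eq_bigr => i _ /=.
rewrite scaler_sumr -big_split; apply: eq_bigr => j _ /=.
rewrite scaler_sumr -big_split; apply: eq_bigr => l _ /=.
by rewrite !mxE mulrDr scalerDl scalerA mulrCA.
Qed.

Lemma ext_trilin_ext U V W Z (T : 'Hom(U, 'Hom(V, 'Hom(W, Z)))) x y z :
  ext_trilin T (ext R x) (ext R y) (ext R z) = ext R (T x y z).
Proof.
rewrite {2}(ebasis_gen x) linear_sum /= !sum_lfunE ext_sum.
apply: eq_bigr => i _; rewrite {2}(ebasis_gen y) linear_sum /= sum_lfunE.
rewrite ext_sum; apply: eq_bigr => j _.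
rewrite {2}(ebasis_gen z) linear_sum ext_sum.
apply: eq_bigr => l _ /=.
set a := coord _ i x; set b := coord _ j y; set c := coord _ l z.
have -> : T (a *: ebasis i) = a *: T (ebasis i) by exact: linearZ.
rewrite scale_lfunE.
have -> : T (ebasis i) (b *: ebasis j) = b *: T (ebasis i) (ebasis j).
  exact: linearZ.
rewrite !scale_lfunE.
have -> : T (ebasis i) (ebasis j) (c *: ebasis l)
          = c *: T (ebasis i) (ebasis j) (ebasis l) by exact: linearZ.
by rewrite !mxE !extZ !scalerA.
Qed.

(** Pushes linear combinations out of the extended operations: closes the
    linear step of [ext_ind]. *)
Definition extlinE := (ext_form_linl, ext_form_linr, ext_bilin_linl,
  ext_bilin_linr, ext_trilin_linl, ext_trilin_linm, ext_trilin_linr,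
  row_linP).

Definition ext_hom U W (f : 'Hom(U, W)) : 'M[R]_(\dim {:U}, \dim {:W}) :=
  \matrix_i ext R (f (ebasis i)).

Lemma ext_homE U W (f : 'Hom(U, W)) x : ext R x *m ext_hom f = ext R (f x).
Proof.
rewrite {2}(ebasis_gen x) linear_sum ext_sum mulmx_sum_row.
by apply: eq_bigr => i _; rewrite rowK linearZ extZ mxE.
Qed.

Lemma row_ext U W (A B : 'M[R]_(\dim {:U}, \dim {:W})) :
  (forall x : U, ext R x *m A = ext R x *m B) -> A = B.
Proof.
by move=> e; apply/row_matrixP => i; rewrite !rowE -ext_ebasis.
Qed.

(** The base step of [ext_ind]: reduces an identity between elements
    $x\otimes 1$ to the ground field. *)
Definition extE := (ext_homE, ext_form_ext, ext_bilin_ext, ext_trilin_ext).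

Lemma mx_of_lin U W (g : U@R -> W@R) :
  linear g -> {A : 'M[R]_(\dim {:U}, \dim {:W}) | forall u, u *m A = g u}.
Proof.
move=> glin; exists (lin1_mx g) => u.
pose m := GRing.isLinear.Build R _ _ *:%R g glin.
pose h : {linear U@R -> W@R} := HB.pack g m.
exact: (mul_rV_lin1 h).
Qed.

End Ext.

(** * Gradings and isomorphisms over an extension of scalars *)

Section Gradings.
Variables (F : fieldType) (R : kalgebra F).
Local Notation "U @R" := ('rV[R]_(\dim {:U})) (at level 2, format "U @R").
Implicit Types U V W Z : superspace F.

Definition pmx U (a : bool) : 'M[R]_(\dim {:U}) := ext_hom R (hcomp U a).

Definition even_mx U W (A : 'M[R]_(\dim {:U}, \dim {:W})) : Prop :=
  forall a (u : U@R), ext_part a u -> ext_part a (u *m A : W@R).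

Definition iso_mx n m (A : 'M[R]_(n, m)) : Prop :=
  exists B, A *m B = 1%:M /\ B *m A = 1%:M.

Lemma pmxE U a (x : U) : ext R x *m pmx U a = ext R (hcomp U a x).
Proof. exact: ext_homE. Qed.

Lemma pmx_sum U (u : U@R) : graded U ->
  u = u *m pmx U false + u *m pmx U true.
Proof.
move=> gU; elim/ext_ind: u => [k u v {1}-> {1}->|x].
  by rewrite !row_linP scalerDr addrACA.
by rewrite !pmxE -extD -hcomp_sum.
Qed.

Lemma pmx_pmx U a c (u : U@R) : graded U ->
  u *m pmx U a *m pmx U c = if c == a then u *m pmx U a else 0.
Proof.
move=> gU; elim/ext_ind: u => [k u v Hu Hv|x].
  rewrite !row_linP Hu Hv; case: ifP => // _.
  by rewrite scaler0 addr0.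
by rewrite !pmxE (hcomp_id c gU (hcomp_mem a x)); case: ifP; rewrite ?ext0.
Qed.

Lemma pmx_ind U (P : U@R -> Prop) : graded U ->
  (forall k u v, P u -> P v -> P (k *: u + v)) ->
  (forall a u, P (u *m pmx U a)) -> forall u, P u.
Proof.
move=> gU PD Pp u; rewrite (pmx_sum u gU) -[u *m pmx U false]scale1r.
exact: PD.
Qed.

Lemma ext_partP U a (u : U@R) : graded U ->
  ext_part a u <-> u *m pmx U a = u.
Proof.
move=> gU; split=> [[c ->]|<-].
  rewrite mulmx_suml; apply: eq_bigr => i _; rewrite -scalemxAl pmxE.
  have ia : (vbasis (part U a))`_i \in part U a.
    by rewrite vbasis_mem // mem_nth ?size_tuple.
  by rewrite (hcomp_id a gU ia) eqxx.
elim/ext_ind: u => [k u v [c Hu] [d Hv]|x].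
  exists (fun i => k * c i + d i).
  rewrite row_linP Hu Hv scaler_sumr -big_split.
  by apply: eq_bigr => i _; rewrite scalerDl scalerA.
rewrite pmxE.
exists (fun i => kstr R (coord (vbasis (part U a)) i (hcomp U a x))).
rewrite {1}(coord_vbasis (hcomp_mem a x)) ext_sum.
by apply: eq_bigr => i _; rewrite extZ.
Qed.

(** Evenness as commutation with the projections on the homogeneous parts: an
    equation, hence available for rewriting and inherited by inverses. *)
Lemma even_mxP U W (A : 'M[R]_(\dim {:U}, \dim {:W})) :
  graded U -> graded W ->
  even_mx A <-> forall a (u : U@R), u *m pmx U a *m A = u *m A *m pmx W a.
Proof.
move=> gU gW; split=> [eA a u | eA a u].
  have pA c (v : U@R) : v *m pmx U c *m A *m pmx W c = v *m pmx U c *m A.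
    apply/ext_partP => //; apply: eA; apply/ext_partP => //.
    by rewrite pmx_pmx // eqxx.
  rewrite {2}(pmx_sum u gU) !mulmxDl -(pA false) -(pA true) !pmx_pmx //.
  by rewrite -[LHS]pA; case: a => /=; rewrite ?addr0 ?add0r.
by move=> /ext_partP ua; apply/ext_partP => //; rewrite -eA ua.
Qed.

Lemma even_mx_hom U W (phi : 'Hom(U, W)) : graded U -> graded W ->
  even_map phi -> even_mx (ext_hom R phi).
Proof.
move=> gU gW ephi; apply/even_mxP => // a u.
elim/ext_ind: u => [k u v Hu Hv|x]; first by rewrite !row_linP Hu Hv.
rewrite !pmxE !ext_homE; congr (ext R _).
rewrite {2}(hcomp_sum x gU) !linearD /=.
rewrite (hcomp_id a gW (ephi _ _ (hcomp_mem false x))).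
rewrite (hcomp_id a gW (ephi _ _ (hcomp_mem true x))).
by case: a => /=; rewrite ?addr0 ?add0r.
Qed.

Lemma hom_inverse (U W : vectType F) (phi : 'Hom(U, W)) : bijective phi ->
  exists psi : 'Hom(W, U), cancel phi psi /\ cancel psi phi.
Proof.
move=> bij; exists (phi^-1)%VF.
have inj : lker phi == 0%VS by apply/lker0P; apply: bij_inj.
have phiK := lker0_lfunK inj.
split=> // y; have [psi _ psiK] := bij.
by rewrite -[y]psiK phiK.
Qed.

Lemma iso_mx_hom (U W : vectType F) (phi : 'Hom(U, W)) :
  bijective phi -> iso_mx (ext_hom R phi).
Proof.
move=> /hom_inverse[psi [phiK psiK]]; exists (ext_hom R psi).
by split; apply: row_ext => x; rewrite mulmxA !ext_homE mulmx1 ?phiK ?psiK.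
Qed.

Lemma even_mx_mul U V W (A : 'M[R]_(\dim {:U}, \dim {:V}))
    (B : 'M[R]_(\dim {:V}, \dim {:W})) :
  even_mx A -> even_mx B -> even_mx (A *m B).
Proof. by move=> eA eB a u ua; rewrite mulmxA; apply/eB/eA. Qed.

Lemma even_mx_inv U W (A : 'M[R]_(\dim {:U}, \dim {:W})) B :
  graded U -> graded W -> A *m B = 1%:M -> B *m A = 1%:M ->
  even_mx A -> even_mx B.
Proof.
move=> gU gW AB BA /(even_mxP _ gU gW) eA; apply/even_mxP => // a u.
have := eA a (u *m B); rewrite -(mulmxA u B A) BA mulmx1 => <-.
by rewrite -[LHS]mulmxA AB mulmx1.
Qed.

Lemma iso_mx_mul n m p (A : 'M[R]_(n, m)) (B : 'M[R]_(m, p)) :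
  iso_mx A -> iso_mx B -> iso_mx (A *m B).
Proof.
case=> [A' [AA' A'A]] [B' [BB' B'B]]; exists (B' *m A').
by rewrite !mulmxA -(mulmxA A) BB' mulmx1 AA' -(mulmxA B') A'A mulmx1.
Qed.

End Gradings.

Section Isos.
Variables (F : fieldType) (R : kalgebra F).

(** The $R$-points of the scheme of isomorphisms between two objects. Equal
    source and target give the automorphism schemes, the ground field gives
    the isomorphisms of objects: both are treated at once. *)
Definition iso_lsm (X Y : lsm F) (g1 : 'M[R]_(\dim {:alg X}, \dim {:alg Y}))
    (g2 : 'M[R]_(\dim {:smod X}, \dim {:smod Y})) : Prop :=
  [/\ (iso_mx g1 /\ even_mx g1) /\ (iso_mx g2 /\ even_mx g2),
      forall x y, ext_bilin (br X) x y *m g1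
                  = ext_bilin (br Y) (x *m g1) (y *m g1),
      forall x v, ext_bilin (act X) x v *m g2
                  = ext_bilin (act Y) (x *m g1) (v *m g2)
    & forall x y, ext_form (bform Y) (x *m g1) (y *m g1)
                  = ext_form (bform X) x y].

Definition iso_superpair (V W : superpair F)
    (h1 : 'M[R]_(\dim {:Vm V}, \dim {:Vm W}))
    (h2 : 'M[R]_(\dim {:Vp V}, \dim {:Vp W})) : Prop :=
  [/\ (iso_mx h1 /\ even_mx h1) /\ (iso_mx h2 /\ even_mx h2),
      forall x y z, ext_trilin (Dm V) x y z *m h1
                    = ext_trilin (Dm W) (x *m h1) (y *m h2) (z *m h1),
      forall x y z, ext_trilin (Dp V) x y z *m h2
                    = ext_trilin (Dp W) (x *m h2) (y *m h1) (z *m h2)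
    & forall f v, ext_form (pform W) (f *m h1) (v *m h2)
                  = ext_form (pform V) f v].

Lemma Aut_lsmE (X : lsm F) g : Aut_lsm X R g <-> iso_lsm (X := X) (Y := X) g.1 g.2.
Proof. by []. Qed.

Lemma Aut_superpairE (V : superpair F) h :
  Aut_superpair V R h <-> iso_superpair (V := V) (W := V) h.1 h.2.
Proof. by []. Qed.

Lemma iso_lsm_hom (X Y : lsm F) (phi0 : 'Hom(alg X, alg Y))
    (phip : 'Hom(smod X, smod Y)) :
  graded (alg X) -> graded (alg Y) -> graded (smod X) -> graded (smod Y) ->
  even_iso phi0 -> even_iso phip ->
  (forall x y, phi0 (br X x y) = br Y (phi0 x) (phi0 y)) ->
  (forall x v, phip (act X x v) = act Y (phi0 x) (phip v)) ->
  (forall x y, bform Y (phi0 x) (phi0 y) = bform X x y) ->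
  iso_lsm (ext_hom R phi0) (ext_hom R phip).
Proof.
move=> gLX gLY gMX gMY [i0 e0] [ip ep] Hbr Hact Hb; split.
- by split; split; do ?[exact: iso_mx_hom | exact: even_mx_hom].
- elim/ext_ind => [k u v Hu Hv|x] y; first by rewrite !extlinE Hu Hv.
  elim/ext_ind: y => [k u v Hu Hv|y]; first by rewrite !extlinE Hu Hv.
  by rewrite !extE Hbr.
- elim/ext_ind => [k u v Hu Hv|x] y; first by rewrite !extlinE Hu Hv.
  elim/ext_ind: y => [k u v Hu Hv|y]; first by rewrite !extlinE Hu Hv.
  by rewrite !extE Hact.
- elim/ext_ind => [k u v Hu Hv|x] y; first by rewrite !extlinE Hu Hv.
  elim/ext_ind: y => [k u v Hu Hv|y]; first by rewrite !extlinE Hu Hv.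
  by rewrite !extE Hb.
Qed.

Lemma iso_superpair_hom (V W : superpair F) (phim : 'Hom(Vm V, Vm W))
    (phip : 'Hom(Vp V, Vp W)) :
  graded (Vm V) -> graded (Vm W) -> graded (Vp V) -> graded (Vp W) ->
  even_iso phim -> even_iso phip ->
  (forall x y z, phim (Dm V x y z) = Dm W (phim x) (phip y) (phim z)) ->
  (forall x y z, phip (Dp V x y z) = Dp W (phip x) (phim y) (phip z)) ->
  (forall x y, pform W (phim x) (phip y) = pform V x y) ->
  iso_superpair (ext_hom R phim) (ext_hom R phip).
Proof.
move=> gmV gmW gpV gpW [im em] [ip ep] Hm Hp Hb; split.
- by split; split; do ?[exact: iso_mx_hom | exact: even_mx_hom].
- elim/ext_ind => [k u v Hu Hv|x] y z; first by rewrite !extlinE Hu Hv.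
  elim/ext_ind: y => [k u v Hu Hv|y]; first by rewrite !extlinE Hu Hv.
  elim/ext_ind: z => [k u v Hu Hv|z]; first by rewrite !extlinE Hu Hv.
  by rewrite !extE Hm.
- elim/ext_ind => [k u v Hu Hv|x] y z; first by rewrite !extlinE Hu Hv.
  elim/ext_ind: y => [k u v Hu Hv|y]; first by rewrite !extlinE Hu Hv.
  elim/ext_ind: z => [k u v Hu Hv|z]; first by rewrite !extlinE Hu Hv.
  by rewrite !extE Hp.
- elim/ext_ind => [k u v Hu Hv|x] y; first by rewrite !extlinE Hu Hv.
  elim/ext_ind: y => [k u v Hu Hv|y]; first by rewrite !extlinE Hu Hv.
  by rewrite !extE Hb.
Qed.

Lemma iso_superpair_comp (V W Z : superpair F) h1 h2 k1 k2 :
  iso_superpair (V := V) (W := W) h1 h2 ->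
  iso_superpair (V := W) (W := Z) k1 k2 ->
  iso_superpair (V := V) (W := Z) (h1 *m k1) (h2 *m k2).
Proof.
case=> [[[i1 e1] [i2 e2]] Hm Hp Hb] [[[j1 d1] [j2 d2]] Km Kp Kb]; split.
- by split; split; do ?[exact: iso_mx_mul | exact: even_mx_mul].
- by move=> x y z; rewrite !mulmxA Hm Km.
- by move=> x y z; rewrite !mulmxA Hp Kp.
- by move=> f v; rewrite !mulmxA Kb Hb.
Qed.

Lemma iso_superpair_inv (V W : superpair F) h1 h2 k1 k2 :
  graded (Vm V) -> graded (Vm W) -> graded (Vp V) -> graded (Vp W) ->
  iso_superpair (V := V) (W := W) h1 h2 ->
  h1 *m k1 = 1%:M -> k1 *m h1 = 1%:M -> h2 *m k2 = 1%:M -> k2 *m h2 = 1%:M ->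
  iso_superpair (V := W) (W := V) k1 k2.
Proof.
move=> gmV gmW gpV gpW [[[i1 e1] [i2 e2]] Hm Hp Hb] hk1 kh1 hk2 kh2.
have KH1 x : x *m k1 *m h1 = x by rewrite -mulmxA kh1 mulmx1.
have KH2 x : x *m k2 *m h2 = x by rewrite -mulmxA kh2 mulmx1.
have I1 x y : x *m h1 = y -> x = y *m k1.
  by move=> <-; rewrite -mulmxA hk1 mulmx1.
have I2 x y : x *m h2 = y -> x = y *m k2.
  by move=> <-; rewrite -mulmxA hk2 mulmx1.
split.
- split; split; first by exists h1.
  + exact: even_mx_inv hk1 kh1 _.
  + by exists h2.
  + exact: even_mx_inv hk2 kh2 _.
- by move=> x y z; apply/esym/I1; rewrite Hm !(KH1, KH2).
- by move=> x y z; apply/esym/I2; rewrite Hp !(KH1, KH2).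
- by move=> f v; rewrite -Hb !(KH1, KH2).
Qed.

End Isos.

Section GroundField.
Variable F : fieldType.

Definition base_kalgebra : kalgebra F := Kalgebra (kring := F) idfun.
Local Notation R := base_kalgebra.

Lemma hom_of_mx (U W : vectType F) (A : 'M[R]_(\dim {:U}, \dim {:W})) :
  exists phi : 'Hom(U, W), forall x, ext R (phi x) = ext R x *m A.
Proof.
pose f (x : U) : W := \sum_i (ext R x *m A) 0 i *: (ebasis i : W).
have flin : linear f.
  move=> k x y; rewrite /f extP row_linP scaler_sumr -big_split.
  by apply: eq_bigr => i _; rewrite !mxE scalerDl scalerA.
exists (linfun f) => x; rewrite linfun_val // [RHS]ext_gen ext_sum.
by apply: eq_bigr => i _; rewrite extZ.
Qed.

Lemma ext_inj (U : vectType F) : injective (ext (U := U) R).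
Proof.
move=> x y /rowP e; rewrite (ebasis_gen x) (ebasis_gen y).
by apply: eq_bigr => i _; have := e i; rewrite !mxE /= => ->.
Qed.

Lemma even_iso_of_mx (U W : superspace F) (A : 'M[R]_(\dim {:U}, \dim {:W}))
    (phi : 'Hom(U, W)) : graded U -> graded W ->
  (forall x, ext R (phi x) = ext R x *m A) -> iso_mx A -> even_mx A ->
  even_iso phi.
Proof.
move=> gU gW phiA [B [AB BA]] /(even_mxP _ gU gW) eA; split.
  have [psi psiB] := hom_of_mx B.
  exists psi => x; apply: ext_inj; rewrite (psiB, phiA) (psiB, phiA).
    by rewrite -mulmxA AB mulmx1.
  by rewrite -mulmxA BA mulmx1.
move=> a x xa; have xE : hcomp U a x = x by rewrite (hcomp_id a gU xa) eqxx.
suff -> : phi x = hcomp W a (phi x) by apply: hcomp_mem.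
by apply: ext_inj; rewrite -pmxE phiA -eA // pmxE xE.
Qed.

(** Over the ground field every vector is of the form $x\otimes 1$, so matrices
    and linear maps carry the same information. *)
Lemma lsm_isoP (X Y : lsm F) :
  graded (alg X) -> graded (alg Y) -> graded (smod X) -> graded (smod Y) ->
  lsm_iso X Y <-> exists g1 g2, iso_lsm (R := R) (X := X) (Y := Y) g1 g2.
Proof.
move=> gLX gLY gMX gMY; split=> [[phi0 [phip [[e0 ep] Hbr Hact Hb]]]|].
  by exists (ext_hom R phi0), (ext_hom R phip); apply: iso_lsm_hom.
case=> g1 [g2 [[[i1 e1] [i2 e2]] Hbr Hact Hb]].
have [phi0 E0] := hom_of_mx g1; have [phip Ep] := hom_of_mx g2.
exists phi0, phip; split.
- by split; [apply: even_iso_of_mx E0 _ _ | apply: even_iso_of_mx Ep _ _].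
- by move=> x y; apply: ext_inj; rewrite E0 -!ext_bilin_ext Hbr !E0.
- by move=> x y; apply: ext_inj; rewrite Ep -!ext_bilin_ext Hact !(E0, Ep).
- move=> x y; have := Hb (ext R x) (ext R y).
  by rewrite -!E0 !ext_form_ext.
Qed.

Lemma superpair_isoP (V W : superpair F) :
  graded (Vm V) -> graded (Vm W) -> graded (Vp V) -> graded (Vp W) ->
  superpair_iso V W <->
    exists h1 h2, iso_superpair (R := R) (V := V) (W := W) h1 h2.
Proof.
move=> gmV gmW gpV gpW; split=> [[phim [phip [[em ep] Hm Hp Hb]]]|].
  by exists (ext_hom R phim), (ext_hom R phip); apply: iso_superpair_hom.
case=> h1 [h2 [[[i1 e1] [i2 e2]] Hm Hp Hb]].
have [phim E1] := hom_of_mx h1; have [phip E2] := hom_of_mx h2.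
exists phim, phip; split.
- by split; [apply: even_iso_of_mx E1 _ _ | apply: even_iso_of_mx E2 _ _].
- by move=> x y z; apply: ext_inj; rewrite E1 -!ext_trilin_ext Hm !(E1, E2).
- by move=> x y z; apply: ext_inj; rewrite E2 -!ext_trilin_ext Hp !(E1, E2).
- move=> x y; have := Hb (ext R x) (ext R y).
  by rewrite -E1 -E2 !ext_form_ext.
Qed.

End GroundField.

(** * The Faulkner construction *)

Section Homogeneous.
Variable F : fieldType.

Lemma homog_ind (U : superspace F) (P : U -> Prop) : graded U ->
  (forall u v, P u -> P v -> P (u + v)) ->
  (forall a x, x \in part U a -> P x) -> forall x, P x.
Proof.
move=> gU PD Ph x; rewrite (hcomp_sum x gU).
by apply: PD; apply: Ph (hcomp_mem _ _).
Qed.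

Lemma GJSP_graded (V : superpair F) : GJSP V -> graded (Vm V) /\ graded (Vp V).
Proof. by case=> -[? _ _] [? _ _]. Qed.

Lemma FLSM_graded (X : lsm F) : FLSM X -> graded (alg X) /\ graded (smod X).
Proof. by case=> -[? _ _ _] [[? _ _] _]. Qed.

Lemma part_sub (U : superspace F) a :
  (part U a <= part U false + part U true)%VS.
Proof. by case: a; rewrite ?addvSr ?addvSl. Qed.

Lemma graded_intro (U : superspace F) :
  (forall x, x \in (part U false + part U true)%VS) ->
  (forall x, x \in part U false -> x \in part U true -> x = 0) -> graded U.
Proof.
move=> U1 U0; split; apply/eqP.
  by rewrite eqEsubv subvf; apply/subvP => x _.
rewrite -subv0; apply/subvP => x; rewrite memv_cap memv0 => /andP[x0 x1].
exact/eqP/U0.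
Qed.

Lemma form_separates (U V : vectType F) (b : 'Hom(U, 'Hom(V, F^o))) y z :
  nondegenerate b -> (forall x, b x y = b x z) -> y = z.
Proof.
move=> [_ nd] e; apply/eqP; rewrite -subr_eq0; apply/eqP/nd => x.
by rewrite linearB /= e subrr.
Qed.

Lemma form_separates_l (U V : vectType F) (b : 'Hom(U, 'Hom(V, F^o))) y z :
  nondegenerate b -> (forall x, b y x = b z x) -> y = z.
Proof.
move=> [nd _] e; apply/eqP; rewrite -subr_eq0; apply/eqP/nd => x.
by rewrite linearB /= add_lfunE opp_lfunE e subrr.
Qed.

Lemma bilinNZl (U V W : vectType F) (B : 'Hom(U, 'Hom(V, W))) k x y :
  B (- (k *: x)) y = - (k *: B x y).
Proof. by rewrite linearN linearZ /= opp_lfunE scale_lfunE. Qed.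

Lemma bilin_linl (U V W : vectType F) (B : 'Hom(U, 'Hom(V, W))) k x x' y :
  B (k *: x + x') y = k *: B x y + B x' y.
Proof. by rewrite linearP /= add_lfunE scale_lfunE. Qed.

Lemma bilin_linr (U V W : vectType F) (B : 'Hom(U, 'Hom(V, W))) k x y y' :
  B x (k *: y + y') = k *: B x y + B x y'.
Proof. exact: linearP. Qed.

Lemma form_linl (U V : vectType F) (b : 'Hom(U, 'Hom(V, F^o))) k x x' y :
  b (k *: x + x') y = k * b x y + b x' y.
Proof. exact: bilin_linl. Qed.

Lemma form_linr (U V : vectType F) (b : 'Hom(U, 'Hom(V, F^o))) k x y y' :
  b x (k *: y + y') = k * b x y + b x y'.
Proof. exact: bilin_linr. Qed.

Lemma linNZ (U V : vectType F) (B : 'Hom(U, V)) k x :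
  B (- (k *: x)) = - (k *: B x).
Proof. by rewrite linearN linearZ. Qed.

End Homogeneous.

(** Computes signs whose parities are concrete; an identity between signs is
    proved by case analysis on the parities. *)
Ltac signs := rewrite /eta3 /eta /= ?expr0 ?expr1;
  rewrite ?(mul1r, mulr1, mulN1r, mulrN1, opprK, mulrN, mulNr) //.

Section FaulknerSuperpair.
Variables (F : fieldType) (X : lsm F).
Hypothesis FX : FLSM X.

Local Notation L := (alg X).
Local Notation M := (smod X).
Local Notation M' := (dual_superspace M).
Local Notation b := (bform X).
Local Notation act := (Defs.act X).
Local Notation dact := (dual_act act).

Let ndb : nondegenerate b. Proof. by case: FX => _ _ []. Qed.
Let hb : homogeneous_form b. Proof. by case: FX => _ _ []. Qed.
Let gL : graded L. Proof. by case: FX => -[]. Qed.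
Let gM : graded M. Proof. by case: FX => _ [[]]. Qed.
Let gM' : graded M'. Proof. exact: graded_dual. Qed.

(** The brackets $[f,v]$ and $[v,f]$ as bilinear maps. *)
Definition fvbr : 'Hom(M', 'Hom(M, L)) := linfun2 (@br_fv F X).
Definition vfbr : 'Hom(M, 'Hom(M', L)) := linfun2 (@br_vf F X).

Lemma fvbrE f v : fvbr f v = br_fv f v.
Proof.
apply: linfun2E => [{}f k u w|{}v k f1 f2]; apply/esym/br_fvP => // x;
  rewrite linearP /= !br_fvE //; first by rewrite linearP.
by rewrite linearP /= add_lfunE scale_lfunE.
Qed.

Lemma vfbrE v f : vfbr v f = br_vf v f.
Proof.
apply: linfun2E => [{}v k f1 f2|{}f k u w]; apply/esym/br_vfP => // x;
  rewrite linearP /= !br_vfE //; first by rewrite pair_vf_linr.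
by rewrite linearP /= pair_vf_linl.
Qed.

Lemma form_fvbr x f v : b x (fvbr f v) = dact x f v.
Proof. by rewrite fvbrE br_fvE. Qed.

Lemma form_vfbr x v f : b x (vfbr v f) = pair_vf (act x v) f.
Proof. by rewrite vfbrE br_vfE. Qed.

Lemma faulkner_Dm f v g : Dm (faulkner X) f v g = dact (fvbr f v) g.
Proof. by rewrite faulkner_DmE // fvbrE. Qed.

Lemma faulkner_Dp v f w : Dp (faulkner X) v f w = act (vfbr v f) w.
Proof. by rewrite faulkner_DpE // vfbrE. Qed.

Lemma act_part a c x v : x \in part L a -> v \in part M c ->
  act x v \in part M (a (+) c).
Proof. by case: FX => _ [[_ H _] _] _; apply: H. Qed.

Lemma actM a c x y v : x \in part L a -> y \in part L c ->
  act (br X x y) v = act x (act y v) - eta F a c *: act y (act x v).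
Proof. by case: FX => _ [[_ _ H] _] _; apply: H. Qed.

Lemma dactE a c x f v : x \in part L a -> f \in part M' c ->
  dact x f v = - (eta F a c * f (act x v)).
Proof. exact: dual_act_homogE. Qed.

Lemma dact_part a c x f : x \in part L a -> f \in part M' c ->
  dact x f \in part M' (a (+) c).
Proof.
move=> xa fc; apply/mem_dual_part => v vac; rewrite (dactE _ xa fc).
have /mem_dual_part -> := fc; first by rewrite mulr0 oppr0.
by have := act_part xa vac; rewrite addbN addKb.
Qed.

Lemma dactM a c x y f : x \in part L a -> y \in part L c ->
  dact (br X x y) f = dact x (dact y f) - eta F a c *: dact y (dact x f).
Proof.
move=> xa yc; elim/homog_ind: f => [//|f g Hf Hg|d f fd].
  do 5!rewrite linearD /=.
  by rewrite Hf Hg; rewrite scalerDr opprD addrACA.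
have xy : br X x y \in part L (a (+) c) by case: FX => -[_ H _ _] _ _; apply: H.
apply/lfunP=> v; rewrite (dactE _ xy fd) !lfunE /= opp_lfunE scale_lfunE.
rewrite (dactE _ xa (dact_part yc fd)) (dactE _ yc fd).
rewrite (dactE _ yc (dact_part xa fd)) (dactE _ xa fd).
rewrite (actM _ xa yc) linearB linearZ /=.
case: (a); case: (c); case: (d); signs.
all: by rewrite ?scale1r ?scaleN1r ?opprK ?opprD ?opprK addrC.
Qed.

(** Both brackets are dual to the action of $L$, on $M^*$ and on $M$, and these
    two actions differ by a sign. *)
Lemma vfbr_fvbr a c v f : v \in part M a -> f \in part M' c ->
  vfbr v f = - (eta F a c *: fvbr f v).
Proof.
move=> va fc; apply: (form_separates ndb) => x.
elim/homog_ind: x => [//|x y Hx Hy|d x xd].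
  by rewrite linearD /= !add_lfunE Hx Hy.
rewrite linearN linearZ /= form_vfbr form_fvbr (dactE _ xd fc).
rewrite (pair_vfE gM (act_part xd va) fc) -mulrN opprK mulrA.
by congr (_ * _); case: (a); case: (c); case: (d); signs.
Qed.

(** The component of the wrong parity is orthogonal to $L$: against elements
    of its own parity the form gives $f(x\cdot v)$ for $f$ and $x\cdot v$ of
    distinct parities. *)
Lemma fvbr_part a c f v : f \in part M' a -> v \in part M c ->
  fvbr f v \in part L (a (+) c).
Proof.
move=> fa vc; set l := fvbr f v; set s := a (+) c.
suff z : hcomp L (~~ s) l = 0.
  have := hcomp_mem s l; have := hcomp_sum l gL.
  by case: (s) z => /= ->; rewrite ?addr0 ?add0r => <-.
apply: (form_separates ndb) => x; rewrite linear0.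
elim/homog_ind: x => [//|x y Hx Hy|d x xd].
  by rewrite linearD /= add_lfunE Hx Hy addr0.
have [ds|ds] := eqVneq d (~~ s); last by apply: hb xd (hcomp_mem _ _) ds.
have e : b x (hcomp L s l) = 0.
  by apply: hb xd (hcomp_mem _ _) _; rewrite ds; case: (s).
transitivity (b x l).
  rewrite {2}(hcomp_sum l gL) linearD.
  by case: (s) e => /= ->; rewrite ?addr0 ?add0r.
rewrite form_fvbr (dactE _ xd fa).
have /mem_dual_part -> := fa; first by rewrite mulr0 oppr0.
by have := act_part xd vc; rewrite ds /s addNb addbK.
Qed.

Lemma vfbr_part a c v f : v \in part M a -> f \in part M' c ->
  vfbr v f \in part L (a (+) c).
Proof.
by move=> va fc; rewrite (vfbr_fvbr va fc) rpredN rpredZ // addbC fvbr_part.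
Qed.

(** Equivariance of the bracket. Against $x\in L$, invariance of $b$ turns the
    left-hand side into the action of $[x,l]$ on $f$, and the module axiom
    for $M^*$ gives the two terms on the right. *)
Lemma br_fvbr a c d l f v :
  l \in part L a -> f \in part M' c -> v \in part M d ->
  br X l (fvbr f v) = fvbr (dact l f) v + eta F a c *: fvbr f (act l v).
Proof.
move=> la fc vd; apply: (form_separates ndb) => x.
elim/homog_ind: x => [//|x y Hx Hy|e x xe].
  by rewrite linearD /= !add_lfunE Hx Hy.
have -> : b x (br X l (fvbr f v)) = b (br X x l) (fvbr f v).
  by case: FX => _ _ [].
rewrite linearD linearZ /= !form_fvbr (dactM _ xe la) add_lfunE opp_lfunE.
rewrite scale_lfunE (dactE _ la (dact_part xe fc)) scalerN opprK.
congr (_ + _); rewrite [LHS]mulrA; congr (_ * _).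
by case: (a); case: (c); case: (e); signs.
Qed.

Lemma form_sym a c x y : x \in part L a -> y \in part L c ->
  b x y = eta F a c * b y x.
Proof. by move=> xa yc; case: FX => _ _ [_ _ _ H]; apply: H. Qed.

(** The identity of generalized Jordan superpairs is equivariance of the
    bracket seen through the action on $M^*$, and on $M$ for the other sign. *)
Lemma faulkner_minus_axioms :
  gjsp_axioms (Dm (faulkner X)) (Dp (faulkner X)).
Proof.
split=> [|a c d x y z xa yc zd|a c d e x y z w xa yc zd we]; first exact: gM'.
  by rewrite faulkner_Dm; apply: dact_part zd; apply: fvbr_part.
have xy := fvbr_part xa yc; have zw := fvbr_part zd we.
apply/lfunP => u; rewrite !add_lfunE !opp_lfunE scale_lfunE.
rewrite scale_lfunE !comp_lfunE.
rewrite !faulkner_Dm faulkner_Dp -(dactM _ xy zw) (br_fvbr xy zd we).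
rewrite (vfbr_fvbr yc xa) linearD linearZ /= add_lfunE scale_lfunE.
congr (_ + _); rewrite bilinNZl linNZ bilinNZl scalerN opprK scalerA.
by congr (_ *: _); case: (a); case: (c); case: (d); signs.
Qed.

Lemma faulkner_plus_axioms :
  gjsp_axioms (Dp (faulkner X)) (Dm (faulkner X)).
Proof.
split=> [|a c d x y z xa yc zd|a c d e x y z w xa yc zd we]; first exact: gM.
  by rewrite faulkner_Dp; apply: act_part zd; apply: vfbr_part.
have xy := vfbr_part xa yc; have zw := vfbr_part zd we.
apply/lfunP => u; rewrite !add_lfunE !opp_lfunE scale_lfunE.
rewrite scale_lfunE !comp_lfunE.
rewrite !faulkner_Dp faulkner_Dm -(actM _ xy zw) (vfbr_fvbr zd we).
rewrite linNZ (br_fvbr xy we zd) scalerDr opprD linearD add_lfunE addrC.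
rewrite (vfbr_fvbr (act_part xy zd) we).
have yx := fvbr_part yc xa.
rewrite (vfbr_fvbr zd (dact_part yx we)) !(vfbr_fvbr xa yc).
rewrite !scalerA !(linNZ, bilinNZl).
rewrite !(scalerN, opprK, scalerA); congr (_ *: _ + _ *: _);
  by case: (a); case: (c); case: (d); case: (e); signs.
Qed.

Lemma faulkner_nondegenerate : nondegenerate (pform (faulkner X)).
Proof.
split=> [f f0|v v0].
  by apply/lfunP => v; rewrite -faulkner_formE f0 lfunE.
rewrite (ebasis_gen v); apply: big1 => i _.
have clin : linear (coord (vbasis {:M}) i : M -> F^o) by exact: linearP.
have := v0 (linfun (coord (vbasis {:M}) i : M -> F^o)).
by rewrite faulkner_formE (linfun_val clin) => ->; rewrite scale0r.
Qed.

Lemma faulkner_homogeneous : homogeneous_form (pform (faulkner X)).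
Proof.
move=> a c f v fa vc ac; rewrite faulkner_formE.
move/mem_dual_part: fa; apply.
by move: vc ac; case: (a); case: (c).
Qed.

Lemma faulkner_superinvariant a c d x y z w :
  x \in part M' a -> y \in part M c -> z \in part M' d ->
  pform (faulkner X) (Dm (faulkner X) x y z) w
    = eta3 F a c d * pform (faulkner X) z (Dp (faulkner X) y x w).
Proof.
move=> xa yc zd; rewrite !faulkner_formE faulkner_Dm faulkner_Dp.
rewrite (dactE _ (fvbr_part xa yc) zd) (vfbr_fvbr yc xa) bilinNZl linNZ.
rewrite mulrN mulrA; congr (- (_ * _)).
by case: (a); case: (c); case: (d); signs.
Qed.

(** In these terms supersymmetry of the pairing is supersymmetry of $b$. *)
Lemma faulkner_form_fvbr x y z w :
  pform (faulkner X) (Dm (faulkner X) x y z) w = b (fvbr x y) (fvbr z w).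
Proof. by rewrite faulkner_formE faulkner_Dm form_fvbr. Qed.

Lemma faulkner_supersymmetric_minus a c d e x y z w :
  x \in part M' a -> y \in part M c -> z \in part M' d -> w \in part M e ->
  pform (faulkner X) (Dm (faulkner X) x y z) w
    = eta F (a (+) c) (d (+) e)
      * pform (faulkner X) (Dm (faulkner X) z w x) y.
Proof.
move=> xa yc zd we; rewrite !faulkner_form_fvbr.
exact: form_sym (fvbr_part xa yc) (fvbr_part zd we).
Qed.

Lemma faulkner_supersymmetric_plus a c d e x y z w :
  x \in part M' a -> y \in part M c -> z \in part M' d -> w \in part M e ->
  pform (faulkner X) x (Dp (faulkner X) y z w)
    = eta F (a (+) c) (d (+) e)
      * pform (faulkner X) z (Dp (faulkner X) w x y).
Proof.
move=> xa yc zd we.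
have S u s f v t g i : f \in part M' u -> v \in part M s -> g \in part M' t ->
    pform (faulkner X) g (Dp (faulkner X) v f i)
    = eta3 F u s t * b (fvbr f v) (fvbr g i).
  move=> fu vs gt.
  rewrite -faulkner_form_fvbr (faulkner_superinvariant _ fu vs gt).
  have e3 : eta3 F u s t * eta3 F u s t = 1.
    by case: (u); case: (s); case: (t); signs.
  by rewrite mulrA e3 mul1r.
rewrite (S d c _ _ a) // (S a e _ _ d) // !mulrA.
have zy := fvbr_part zd yc; have xw := fvbr_part xa we.
(* The signs agree only on parities for which the form can be nonzero. *)
have [E|ne] := eqVneq (d (+) c) (a (+) e); last first.
  by rewrite (hb zy xw ne) (hb xw zy) ?mulr0 // eq_sym.
rewrite (form_sym zy xw) mulrA; congr (_ * _).
by move: E; case: (a); case: (c); case: (d); case: (e); signs.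
Qed.

Lemma faulkner_GJSP : GJSP (faulkner X).
Proof.
split.
- exact: faulkner_minus_axioms.
- exact: faulkner_plus_axioms.
- by split; [exact: faulkner_nondegenerate | exact: faulkner_homogeneous].
- by move=> a c d e x y z w xa yc zd _; apply: faulkner_superinvariant.
- move=> a c d e x y z w xa yc zd we; split.
    exact: faulkner_supersymmetric_minus.
  exact: faulkner_supersymmetric_plus.
Qed.

End FaulknerSuperpair.

Lemma purely_even_full (F : fieldType) (U : superspace F) :
  graded U -> purely_even U -> part U false = fullv.
Proof. by move=> [U1 _] U0; rewrite -U1 U0 addv0. Qed.

Lemma faulkner_GJP (F : fieldType) (X : lsm F) : FLM X -> GJP (faulkner X).
Proof.
case=> FX _ M0; split=> //; first exact: faulkner_GJSP.
have [_ [[gM _ _] _] _] := FX.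
apply/eqP; rewrite -subv0; apply/subvP=> f /mem_dual_part f0.
rewrite memv0; apply/eqP/lfunP=> v; rewrite lfunE /=; apply: f0 => /=.
by rewrite purely_even_full // memvf.
Qed.

(** * Nondegenerate forms and the Faulkner construction over R *)

Section Representability.
Variables (F : fieldType) (U V : vectType F) (b : 'Hom(U, 'Hom(V, F^o))).
Hypothesis ndb : nondegenerate b.

Lemma dim_dual (W : vectType F) : \dim {:'Hom(W, F^o)} = \dim {:W}.
Proof. by rewrite !dimvf /dim /= muln1. Qed.

Lemma form_flip_inj : lker (flip b) == 0%VS.
Proof.
apply/lker0P => y z e; apply: (form_separates ndb) => x.
by rewrite -flipE e flipE.
Qed.

Lemma form_inj : lker b == 0%VS.
Proof. by apply/lker0P => y z e; apply: (form_separates_l ndb) => x; rewrite e. Qed.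

Lemma form_reprV (h : 'Hom(U, F^o)) : exists y, forall x, b x y = h x.
Proof.
have le : (\dim {:U} <= \dim {:V})%N.
  rewrite -(@limg_dim_eq _ _ _ b) ?(eqP form_inj) ?capv0 //.
  by rewrite -(dim_dual V) dimvS // subvf.
have : limg (flip b) == fullv.
  rewrite eqEdim subvf /= limg_dim_eq ?(eqP form_flip_inj) ?capv0 //.
  by rewrite dim_dual.
move=> /eqP lf; have hl : h \in limg (flip b) by rewrite lf memvf.
by exists (((flip b)^-1)%VF h) => x; rewrite -flipE limg_lfunVK.
Qed.

Lemma nondegenerate_flip : nondegenerate (flip b).
Proof.
case: ndb => nl nr; split=> [v v0|u u0].
  by apply: nr => x; rewrite -flipE v0.
by apply: nl => y; rewrite -flipE u0.
Qed.

End Representability.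

(** A functional vanishing on $S$ is represented by an element orthogonal to
    $S$, that is by $0$. *)
Lemma separating_full (F : fieldType) (U V : vectType F)
    (b : 'Hom(U, 'Hom(V, F^o))) (S : {vspace V}) : nondegenerate b ->
  (forall x, (forall y, y \in S -> b x y = 0) -> x = 0) -> S = fullv.
Proof.
move=> ndb sep; apply/eqP; rewrite eqEsubv subvf; apply/subvP => v _.
(* The coordinates of $v-\pi_S(v)$ are such functionals of $v$. *)
suff e : v = projv S v by rewrite e memv_proj.
apply/eqP; rewrite -subr_eq0 [v - _]ebasis_gen; apply/eqP; apply: big1 => i _.
have clin : linear (coord (vbasis {:V}) i : V -> F^o) by exact: linearP.
pose h := (linfun (coord (vbasis {:V}) i : V -> F^o) \o (\1 - projv S))%VF.
have hE y : h y = coord (vbasis {:V}) i (y - projv S y).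
  by rewrite comp_lfunE (linfun_val clin) add_lfunE opp_lfunE id_lfunE.
have [x bx] := form_reprV (nondegenerate_flip ndb) h.
suff x0 : x = 0 by rewrite -hE -bx flipE x0 linear0 lfunE scale0r.
by apply: sep => y yS; rewrite -flipE bx hE projv_id // subrr linear0.
Qed.

Section FormsOverR.
Variables (F : fieldType) (R : kalgebra F).
Local Notation "U @R" := ('rV[R]_(\dim {:U})) (at level 2, format "U @R").

Lemma ext_form_flip (U V : vectType F) (b : 'Hom(U, 'Hom(V, F^o)))
    (u : U@R) (v : V@R) : ext_form (flip b) v u = ext_form b u v.
Proof.
elim/ext_ind: u => [k u u' Hu Hu'|x]; first by rewrite !extlinE Hu Hu'.
elim/ext_ind: v => [k v v' Hv Hv'|y]; first by rewrite !extlinE Hv Hv'.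
by rewrite !extE flipE.
Qed.

(** Existence of dual bases; this is how nondegeneracy passes to $R$. *)
Lemma ext_form_coord (U V : vectType F) (b : 'Hom(U, 'Hom(V, F^o)))
    (i : 'I_(\dim {:U})) : nondegenerate b ->
  exists y : V, forall u : U@R, ext_form b u (ext R y) = u 0 i.
Proof.
move=> ndb; have clin : linear (coord (vbasis {:U}) i : U -> F^o).
  exact: linearP.
have [y by_] := form_reprV ndb (linfun (coord (vbasis {:U}) i : U -> F^o)).
exists y; elim/ext_ind => [k u v Hu Hv|x].
  by rewrite !extlinE Hu Hv !mxE.
by rewrite !extE by_ (linfun_val clin) mxE.
Qed.

Lemma ext_form_eql (U V : vectType F) (b : 'Hom(U, 'Hom(V, F^o)))
    (u u' : U@R) : nondegenerate b ->
  (forall v : V@R, ext_form b u v = ext_form b u' v) -> u = u'.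
Proof.
move=> ndb e; apply/rowP => i.
by have [y E] := ext_form_coord i ndb; rewrite -!E e.
Qed.

Lemma ext_form_eqr (U V : vectType F) (b : 'Hom(U, 'Hom(V, F^o)))
    (v v' : V@R) : nondegenerate b ->
  (forall u : U@R, ext_form b u v = ext_form b u v') -> v = v'.
Proof.
move=> ndb e; apply: (ext_form_eql (nondegenerate_flip ndb)) => u.
by rewrite !ext_form_flip.
Qed.

Lemma ext_form_suml (U V : vectType F) (b : 'Hom(U, 'Hom(V, F^o))) n
    (c : 'I_n -> R) (u : 'I_n -> U@R) v :
  ext_form b (\sum_i c i *: u i) v = \sum_i c i * ext_form b (u i) v.
Proof.
elim/big_rec2: _ => [|i s t _ <-]; last by rewrite extlinE.
by apply: big1 => i _; apply: big1 => j _; rewrite mxE !mul0r.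
Qed.

(** The image of $u$ is built on the basis of $U'$ dual to the basis of $V'$. *)
Lemma adjoint_mx (U V U' V' : vectType F) (b : 'Hom(U, 'Hom(V, F^o)))
    (b' : 'Hom(U', 'Hom(V', F^o))) (A : 'M[R]_(\dim {:V'}, \dim {:V})) :
  nondegenerate b' -> exists A' : 'M[R]_(\dim {:U}, \dim {:U'}),
    forall (u : U@R) (v : V'@R), ext_form b' (u *m A') v = ext_form b u (v *m A).
Proof.
move=> /nondegenerate_flip ndb'.
have /fin_all_exists[y Ey] i := ext_form_coord i ndb'.
pose g (u : U@R) : U'@R :=
  \sum_i ext_form b u (ext R (ebasis i : V') *m A) *: ext R (y i).
have glin : linear g.
  move=> k u u'; rewrite /g scaler_sumr -big_split; apply: eq_bigr => i _.
  by rewrite extlinE scalerDl scalerA.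
have [A' EA] := mx_of_lin glin; exists A' => u v.
rewrite EA ext_form_suml {2}[v]ext_gen mulmx_suml -[RHS]ext_form_flip.
under [in RHS]eq_bigr do rewrite -scalemxAl.
rewrite ext_form_suml; apply: eq_bigr => i _.
by rewrite ext_form_flip -[ext_form b' _ _]ext_form_flip Ey mulrC.
Qed.

End FormsOverR.

Section FaulknerOverR.
Variables (F : fieldType) (R : kalgebra F) (X : lsm F).
Hypothesis FX : FLSM X.
Local Notation "U @R" := ('rV[R]_(\dim {:U})) (at level 2, format "U @R").
Local Notation L := (alg X).
Local Notation M := (smod X).
Local Notation M' := (dual_superspace M).
Local Notation pair := (pform (faulkner X)).
Local Notation pmx := (pmx R).

Let ndb : nondegenerate (bform X). Proof. by case: FX => _ _ []. Qed.
Let gL : graded L. Proof. by case: FX => -[]. Qed.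
Let gM : graded M. Proof. by case: FX => _ [[]]. Qed.
Let gM' : graded M'. Proof. exact: graded_dual. Qed.

(** The sign of $\langle v,f\rangle$ depends on $f$ alone, because $f$
    vanishes on the other parity. *)
Lemma pair_vf_homog a v f : f \in part M' a ->
  pair_vf v f = eta F a a * f v.
Proof.
move=> fa; elim/homog_ind: v => [//|u v Hu Hv|c v vc].
  by rewrite -[u]scale1r pair_vf_linl scale1r mul1r Hu Hv linearD mulrDr.
rewrite (pair_vfE gM vc fa); have [-> //|ne] := eqVneq c a.
have /mem_dual_part -> := fa; first by rewrite !mulr0.
by move: ne vc; case: (a); case: (c).
Qed.

(** The same sign as a formula valid without homogeneity, fit for extension of
    scalars. *)
Lemma pair_vf_sub v f : pair_vf v f = f (hcomp M false v) - f (hcomp M true v).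
Proof.
elim/homog_ind: f => [//|f g Hf Hg|a f fa].
  rewrite -[f]scale1r pair_vf_linr scale1r mul1r Hf Hg.
  by rewrite !add_lfunE addrACA -opprD.
rewrite (pair_vf_homog _ fa) {1}(hcomp_sum v gM) linearD.
have z : f (hcomp M (~~ a) v) = 0.
  by have /mem_dual_part := fa; apply; apply: hcomp_mem.
by case: (a) z => /= ->; signs; rewrite ?addr0 ?add0r ?subr0 ?sub0r.
Qed.

(** An element of $L$ orthogonal to all $[v,f]$ annihilates $M$, which is
    faithful. *)
Lemma vfbr_span :
  <<[seq vfbr X v f | v <- vbasis {:M}, f <- vbasis {:M'}]>>%VS = fullv.
Proof.
set S := <<_>>%VS.
have inS v f : vfbr X v f \in S.
  rewrite [v](coord_vbasis (memvf _)) linear_sum sum_lfunE.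
  apply: memv_suml => i _; rewrite linearZ /= scale_lfunE memvZ //.
  rewrite [f](coord_vbasis (memvf _)) linear_sum.
  apply: memv_suml => j _; rewrite linearZ /= memvZ // memv_span //.
  by apply: allpairs_f; rewrite mem_nth ?size_tuple.
apply: (separating_full ndb) => x x0.
have [_ [_ faith] _] := FX; apply: faith => v.
apply: (form_separates (faulkner_nondegenerate X)) => f.
rewrite linear0 faulkner_formE.
elim/homog_ind: f => [//|f g Hf Hg|a f fa].
  by rewrite add_lfunE Hf Hg addr0.
have := x0 _ (inS v f); rewrite form_vfbr // (pair_vf_homog _ fa) => /eqP.
by rewrite mulf_eq0 /eta signr_eq0 => /eqP.
Qed.

Local Notation vf := (ext_bilin (vfbr X)).
Local Notation act := (ext_bilin (Defs.act X)).
Local Notation bR := (ext_form (bform X)).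
Local Notation Dp := (ext_trilin (Defs.Dp (faulkner X))).
Local Notation Dm := (ext_trilin (Defs.Dm (faulkner X))).

(** The elements $[v,f]$ span $L\otimes R$, which makes them the test elements
    for identities that are linear in $x\in L\otimes R$. *)
Lemma vfbr_ind (P : L@R -> Prop) :
  (forall k u v, P u -> P v -> P (k *: u + v)) ->
  (forall v f, P (vf v f)) -> forall x, P x.
Proof.
move=> PD Pvf; have P0 : P 0.
  have := PD (-1) _ _ (Pvf 0 0) (Pvf 0 0).
  by rewrite scaleN1r addNr.
elim/ext_ind => // x.
have /coord_span -> : x \in <<in_tuple
    [seq vfbr X v f | v <- vbasis {:M}, f <- vbasis {:M'}]>>%VS.
  by rewrite vfbr_span memvf.
elim/big_rec: _ => [|i y _ Py]; first by rewrite ext0.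
rewrite extP; apply: PD => //=.
have /allpairsP[[v f] [_ _ ->]] : (in_tuple
    [seq vfbr X v f | v <- vbasis {:M}, f <- vbasis {:M'}])`_i \in
    [seq vfbr X v f | v <- vbasis {:M}, f <- vbasis {:M'}].
  exact: mem_nth.
by rewrite -ext_bilin_ext.
Qed.

Lemma ext_faulkner_Dp (v w : M@R) (f : M'@R) : Dp v f w = act (vf v f) w.
Proof.
elim/ext_ind: v => [k u v Hu Hv|v]; first by rewrite !extlinE Hu Hv.
elim/ext_ind: f => [k f g Hf Hg|f]; first by rewrite !extlinE Hf Hg.
elim/ext_ind: w => [k u w Hu Hw|w]; first by rewrite !extlinE Hu Hw.
by rewrite !extE faulkner_Dp.
Qed.

Lemma ext_form_vfbr (x : L@R) (v : M@R) (f : M'@R) :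
  bR x (vf v f) = ext_form pair f (act x v *m pmx M false)
                  - ext_form pair f (act x v *m pmx M true).
Proof.
have S (k p q r s : R) : k * (p - q) + (r - s) = k * p + r - (k * q + s).
  by rewrite mulrBr opprD addrACA.
elim/ext_ind: x => [k u x Hu Hx|x]; first by rewrite !extlinE Hu Hx S.
elim/ext_ind: v => [k u v Hu Hv|v]; first by rewrite !extlinE Hu Hv S.
elim/ext_ind: f => [k f g Hf Hg|f]; first by rewrite !extlinE Hf Hg S.
by rewrite !extE form_vfbr // pair_vf_sub !faulkner_formE rmorphB.
Qed.

(** Faithfulness survives extension of scalars: the action of $x$ determines
    $b(x,[v,f])$ for all $v$ and $f$. *)
Lemma ext_act_inj (x y : L@R) : (forall v, act x v = act y v) -> x = y.
Proof.
move=> e; apply: (ext_form_eql ndb).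
elim/vfbr_ind => [k u v Hu Hv|v f]; first by rewrite !extlinE Hu Hv.
by rewrite !ext_form_vfbr !e.
Qed.

Lemma ext_act_br a c (x y : L@R) (v : M@R) :
  act (ext_bilin (br X) (x *m pmx L a) (y *m pmx L c)) v
    = act (x *m pmx L a) (act (y *m pmx L c) v)
      - kstr R (eta F a c) *: act (y *m pmx L c) (act (x *m pmx L a) v).
Proof.
set t := kstr R _.
have S (k : R) (p q r s : M@R) :
    k *: (p - t *: q) + (r - t *: s) = k *: p + r - t *: (k *: q + s).
  by rewrite scalerBr scalerDr opprD addrACA !scalerA mulrC.
elim/ext_ind: x => [k u x Hu Hx|x]; first by rewrite !extlinE Hu Hx S.
elim/ext_ind: y => [k u y Hu Hy|y]; first by rewrite !extlinE Hu Hy S.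
elim/ext_ind: v => [k u v Hu Hv|v]; first by rewrite !extlinE Hu Hv S.
rewrite !extE (actM FX _ (hcomp_mem a x) (hcomp_mem c y)).
by rewrite addrC -scaleNr extP rmorphN scaleNr addrC.
Qed.

(** The components of $x$ are visible in its action. *)
Lemma ext_act_pmx a c (x : L@R) (v : M@R) :
  act (x *m pmx L a) (v *m pmx M c) = act x (v *m pmx M c) *m pmx M (a (+) c).
Proof.
elim/ext_ind: x => [k u x Hu Hx|x]; first by rewrite !extlinE Hu Hx.
elim/ext_ind: v => [k u v Hu Hv|v]; first by rewrite !extlinE Hu Hv.
rewrite !extE; congr (ext R _).
rewrite {2}(hcomp_sum x gL) linearD add_lfunE linearD /=.
rewrite !(hcomp_id _ gM (act_part FX (hcomp_mem _ _) (hcomp_mem _ _))).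
by case: (a); case: (c); rewrite /= ?addr0 ?add0r.
Qed.

(** With nondegeneracy of the pairing: the product on $M^*$ is determined by
    that on $M$. *)
Lemma ext_superinvariant a c d (x z : M'@R) (y w : M@R) :
  ext_form pair (Dm (x *m pmx M' a) (y *m pmx M c) (z *m pmx M' d)) w
    = kstr R (eta3 F a c d)
      * ext_form pair (z *m pmx M' d) (Dp (y *m pmx M c) (x *m pmx M' a) w).
Proof.
set t := kstr R _.
have S (k p q : R) : k * (t * p) + t * q = t * (k * p + q).
  by rewrite mulrDr mulrCA.
elim/ext_ind: x => [k u x Hu Hx|x]; first by rewrite !extlinE Hu Hx S.
elim/ext_ind: y => [k u y Hu Hy|y]; first by rewrite !extlinE Hu Hy S.
elim/ext_ind: z => [k u z Hu Hz|z]; first by rewrite !extlinE Hu Hz S.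
elim/ext_ind: w => [k u w Hu Hw|w]; first by rewrite !extlinE Hu Hw S.
rewrite !extE -rmorphM; congr (kstr R _).
by apply: faulkner_superinvariant; rewrite ?hcomp_mem.
Qed.

End FaulknerOverR.

(** * Full faithfulness of the Faulkner construction *)

Section HomogeneousForms.
Variables (F : fieldType) (R : kalgebra F) (U V : superspace F).
Variable b : 'Hom(U, 'Hom(V, F^o)).
Hypotheses (gU : graded U) (gV : graded V) (hb : homogeneous_form b).

(** The projections are self-adjoint for a homogeneous form. *)
Lemma form_hcomp a u v : b (hcomp U a u) v = b u (hcomp V a v).
Proof.
have z c d : c != d -> b (hcomp U c u) (hcomp V d v) = 0.
  exact: hb (hcomp_mem _ _) (hcomp_mem _ _).
rewrite {1}(hcomp_sum v gV) {2}(hcomp_sum u gU) !linearD add_lfunE /=.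
by case: a; rewrite (z true false) // (z false true) // ?addr0 ?add0r.
Qed.

Lemma ext_form_pmx a (u : 'rV[R]_(\dim {:U})) (v : 'rV[R]_(\dim {:V})) :
  ext_form b (u *m pmx R U a) v = ext_form b u (v *m pmx R V a).
Proof.
elim/ext_ind: u => [k u u' Hu Hu'|u]; first by rewrite !extlinE Hu Hu'.
elim/ext_ind: v => [k v v' Hv Hv'|v]; first by rewrite !extlinE Hv Hv'.
by rewrite !extE form_hcomp.
Qed.

End HomogeneousForms.

Section FullFaithfulness.
Variable F : fieldType.
Variable R : kalgebra F.
Implicit Types X Y : lsm F.
Local Notation M' X := (dual_superspace (smod X)).
Local Notation vf X := (ext_bilin (vfbr X)).
Local Notation actR X := (ext_bilin (act X)).
Local Notation Dp X := (ext_trilin (Defs.Dp (faulkner X))).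
Local Notation Dm X := (ext_trilin (Defs.Dm (faulkner X))).
Local Notation pair X := (ext_form (pform (faulkner X))).

Lemma iso_lsm_inj X Y g1 g1' g2 : FLSM Y ->
  iso_lsm (R := R) (X := X) (Y := Y) g1 g2 ->
  iso_lsm (R := R) (X := X) (Y := Y) g1' g2 -> g1 = g1'.
Proof.
move=> FY [[_ [[k2 [_ gk]] _]] _ H _] [_ _ H' _].
apply: row_ext => x; apply: (ext_act_inj FY) => v.
by rewrite -[v]mulmx1 -gk mulmxA -H H'.
Qed.

Lemma pair_adjoint_inj X Y h1 h1' (h2 : 'M[R]_(\dim {:smod X}, \dim {:smod Y})) :
  iso_mx h2 ->
  (forall f v, pair Y (f *m h1) (v *m h2) = pair X f v) ->
  (forall f v, pair Y (f *m h1') (v *m h2) = pair X f v) -> h1 = h1'.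
Proof.
move=> [k2 [_ gk]] H H'; apply: row_ext => x.
apply: (ext_form_eql (faulkner_nondegenerate Y)) => v.
by rewrite -[v]mulmx1 -gk mulmxA H H'.
Qed.

Lemma contragredient X Y (g2 : 'M[R]_(\dim {:smod X}, \dim {:smod Y})) :
  FLSM X -> FLSM Y -> iso_mx g2 -> even_mx g2 ->
  exists g1 : 'M[R]_(\dim {:M' X}, \dim {:M' Y}),
    [/\ iso_mx g1, even_mx g1
      & forall f v, pair Y (f *m g1) (v *m g2) = pair X f v].
Proof.
move=> FX FY [k2 [gk kg]] e2.
have ndX := faulkner_nondegenerate X; have ndY := faulkner_nondegenerate Y.
have [_ gMX] := FLSM_graded FX; have [_ gMY] := FLSM_graded FY.
have [g1 E1] := adjoint_mx (pform (faulkner X)) k2 ndY.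
have [k1 K1] := adjoint_mx (pform (faulkner Y)) g2 ndX.
have E f v : pair Y (f *m g1) (v *m g2) = pair X f v.
  by rewrite E1 -mulmxA gk mulmx1.
exists g1; split=> //.
  exists k1; split; apply: row_ext => f; rewrite mulmx1 mulmxA.
    by apply: (ext_form_eql ndX) => v; rewrite K1 E.
  by apply: (ext_form_eql ndY) => v; rewrite E1 K1 -mulmxA kg mulmx1.
have pmX := ext_form_pmx (R := R) (graded_dual gMX) gMX (@faulkner_homogeneous _ X).
have pmY := ext_form_pmx (R := R) (graded_dual gMY) gMY (@faulkner_homogeneous _ Y).
move/(even_mxP _ gMX gMY): e2 => e2.
apply/even_mxP; do ?exact: graded_dual.
move=> a f; apply: (ext_form_eql ndY) => v.
rewrite -[v]mulmx1 -kg mulmxA; set w := v *m k2.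
by rewrite E pmX pmY -e2 E.
Qed.

(** With the contragredient on $M^*$, an isomorphism respects the bracket
    $[v,f]$ since that is dual to the action. It then respects the product
    of $M$, and by superinvariance that of $M^*$. *)
Lemma iso_lsm_faulkner X Y g1 g2 : FLSM X -> FLSM Y ->
  iso_lsm (R := R) (X := X) (Y := Y) g1 g2 ->
  exists h1, iso_superpair (R := R) (V := faulkner X) (W := faulkner Y) h1 g2.
Proof.
move=> FX FY [[[[k1 [gk1 kg1]] eg1] [ig2 eg2]] Hbr Hact Hb].
have [_ gMX] := FLSM_graded FX; have [_ gMY] := FLSM_graded FY.
have ndY : nondegenerate (bform Y) by case: FY => _ _ [].
have [h1 [ih1 eh1 E]] := contragredient FX FY ig2 eg2.
have [k2 [gk2 kg2]] := ig2.
have c2 := eg2; move/(even_mxP _ gMX gMY): c2 => c2.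
have c1 := eh1.
move/(even_mxP _ (graded_dual gMX) (graded_dual gMY)): c1 => c1.
have Hvf v f : vf X v f *m g1 = vf Y (v *m g2) (f *m h1).
  apply: (ext_form_eqr ndY) => y.
  rewrite -[y]mulmx1 -kg1 mulmxA; set x := y *m k1.
  by rewrite Hb !ext_form_vfbr // -!Hact -!c2 !E.
have HDp x y z : Dp X x y z *m g2 = Dp Y (x *m g2) (y *m h1) (z *m g2).
  by rewrite !ext_faulkner_Dp // Hact Hvf.
have gX' := graded_dual gMX.
exists h1; split=> //; elim/pmx_ind => [//|k u v Hu Hv|a x] y z.
  by rewrite !extlinE Hu Hv.
elim/pmx_ind: y => [//|k u v Hu Hv|c y]; first by rewrite !extlinE Hu Hv.
elim/pmx_ind: z => [//|k u v Hu Hv|d z]; first by rewrite !extlinE Hu Hv.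
apply: (ext_form_eql (faulkner_nondegenerate Y)) => w.
rewrite -[w]mulmx1 -kg2 mulmxA; set v := w *m k2.
have -> : Dm Y (x *m pmx R (M' X) a *m h1) (y *m pmx R (smod X) c *m g2)
              (z *m pmx R (M' X) d *m h1)
    = Dm Y (x *m h1 *m pmx R (M' Y) a) (y *m g2 *m pmx R (smod Y) c)
           (z *m h1 *m pmx R (M' Y) d).
  by congr (ext_trilin _ _ _ _); [exact: c1 | exact: c2 | exact: c1].
rewrite E (ext_superinvariant FX) (ext_superinvariant FY).
by rewrite -!c1 -c2 -HDp E.
Qed.

(** The conjugate of the action of $x$ is again the action of an element of the
    other superalgebra: for $x=[v,f]$ the bracket of the images of $v$ and $f$
    will do, because $[v,f]\cdot w=\{v,f,w\}$. *)
Lemma iso_superpair_lift X Y h1 h2 : FLSM X -> FLSM Y ->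
  (forall x y z, Dp X x y z *m h2 = Dp Y (x *m h2) (y *m h1) (z *m h2)) ->
  exists g1 : 'M[R]_(\dim {:alg X}, \dim {:alg Y}),
    forall x v, actR X x v *m h2 = actR Y (x *m g1) (v *m h2).
Proof.
move=> FX FY H.
have ex (x : 'rV[R]_(\dim {:alg X})) : exists y : 'rV[R]_(\dim {:alg Y}),
    forall v, actR X x v *m h2 = actR Y y (v *m h2).
  elim/vfbr_ind: x => [//|k u v [y Hy] [z Hz]|v f].
    by exists (k *: y + z) => w; rewrite !extlinE Hy Hz.
  exists (vf Y (v *m h2) (f *m h1)) => w.
  by rewrite -!ext_faulkner_Dp.
have /fin_all_exists[y Ey] i := ex (ext R (ebasis i : alg X)).
exists (\matrix_i y i); elim/ext_basis_ind => [|k u u' Hu Hu'|i] v.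
- by rewrite mul0mx !ext_bilin0l mul0mx.
- by rewrite !extlinE Hu Hu'.
by rewrite Ey ext_ebasis -rowE rowK.
Qed.

(** All properties of the lift of $x$ are read off from its action, which is
    faithful; invariance of $b$ is checked against $[v,f]$. *)
Lemma iso_superpair_faulkner X Y h1 h2 : FLSM X -> FLSM Y ->
  iso_superpair (R := R) (V := faulkner X) (W := faulkner Y) h1 h2 ->
  exists g1, iso_lsm (R := R) (X := X) (Y := Y) g1 h2.
Proof.
move=> FX FY H; have [[[ih1 eh1] [ih2 eh2]] Hm Hp E] := H.
have [gLX gMX] := FLSM_graded FX; have [gLY gMY] := FLSM_graded FY.
have gX' := graded_dual gMX; have gY' := graded_dual gMY.
have [[k1 [hk1 kh1]] [k2 [hk2 kh2]]] := (ih1, ih2).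
have [_ _ Kp _] :=
  iso_superpair_inv (V := faulkner X) (W := faulkner Y) gX' gY' gMX gMY H hk1 kh1 hk2 kh2.
have [g1 G] := iso_superpair_lift FX FY Hp.
have [g1' G'] := iso_superpair_lift FY FX Kp.
have c2 := eh2; move/(even_mxP _ gMX gMY): c2 => c2.
have HK v : v *m h2 *m k2 = v by rewrite -mulmxA hk2 mulmx1.
have KH v : v *m k2 *m h2 = v by rewrite -mulmxA kh2 mulmx1.
have c1 a (x : 'rV__) : x *m pmx R (alg X) a *m g1 = x *m g1 *m pmx R (alg Y) a.
  apply: (ext_act_inj FY) => w; rewrite -[w]KH; set v := w *m k2.
  rewrite -G; elim/pmx_ind: v => [//|k u v Hu Hv|c v]; first by rewrite !extlinE Hu Hv.
  by rewrite ext_act_pmx // !c2 ext_act_pmx // G c2.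
have Hvf v f : vf X v f *m g1 = vf Y (v *m h2) (f *m h1).
  apply: (ext_act_inj FY) => w; rewrite -[w]KH; set u := w *m k2.
  by rewrite -G -!ext_faulkner_Dp.
exists g1; split=> //.
- split=> //; split; last by apply/(even_mxP _ gLX gLY).
  exists g1'; split; apply: row_ext => x; rewrite mulmxA mulmx1.
    apply: (ext_act_inj FX) => w; rewrite -{1}[w]HK; set v := w *m h2.
    by rewrite -G' -G HK.
  apply: (ext_act_inj FY) => w; rewrite -{1}[w]KH; set v := w *m k2.
  by rewrite -G -G' KH.
- elim/pmx_ind => [//|k u v Hu Hv|a x] y; first by rewrite !extlinE Hu Hv.
  elim/pmx_ind: y => [//|k u v Hu Hv|c y]; first by rewrite !extlinE Hu Hv.
  apply: (ext_act_inj FY) => w; rewrite -[w]KH; set v := w *m k2.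
  rewrite -G ext_act_br // !c1 ext_act_br // -!c1 -!G.
  by rewrite addrC -scaleNr extlinE scaleNr addrC.
move=> x; elim/vfbr_ind => [//|k u v Hu Hv|v f]; first by rewrite !extlinE Hu Hv.
by rewrite Hvf !ext_form_vfbr // -G -!c2 !E.
Qed.

End FullFaithfulness.

(** * The inner structure superalgebra *)

Lemma regularZ (F : fieldType) (k : F) (x : F^o) : k *: x = k * x :> F.
Proof. by []. Qed.

Section InnerStructure.
Variables (F : fieldType) (V : superpair F).
Hypothesis GV : GJSP V.

Local Notation E :=
  (prod_superspace (end_superspace (Vm V)) (end_superspace (Vp V))).
Local Notation instr := (@instr F V).
Local Notation L := (sub_superspace instr).
Local Notation pair := (pform V).

Let gm : graded (Vm V). Proof. by case: GV => -[]. Qed.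
Let gp : graded (Vp V). Proof. by case: GV => _ []. Qed.
Let ndp : nondegenerate pair. Proof. by case: GV => _ _ []. Qed.
Let hp : homogeneous_form pair. Proof. by case: GV => _ _ []. Qed.

Definition inu (f : Vm V) (v : Vp V) : L := vsproj instr (nu f v).

Lemma inuE f v : vsval (inu f v) = nu f v.
Proof. by rewrite vsprojK // memv_nu. Qed.

Lemma inu1 f v g : (vsval (inu f v)).1 g = Dm V f v g.
Proof. by rewrite inuE. Qed.

Lemma inu2 a c f v w : f \in part (Vm V) a -> v \in part (Vp V) c ->
  (vsval (inu f v)).2 w = - (eta F a c *: Dp V v f w).
Proof.
by move=> fa vc; rewrite inuE (nu_homogE gm gp fa vc) /= opp_lfunE scale_lfunE.
Qed.

Lemma inu_linl k f g v : inu (k *: f + g) v = k *: inu f v + inu g v.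
Proof. by rewrite /inu nu_linl linearP. Qed.

Lemma inu_linr k f v w : inu f (k *: v + w) = k *: inu f v + inu f w.
Proof. by rewrite /inu nu_linr linearP. Qed.

Lemma inu_part a c f v : f \in part (Vm V) a -> v \in part (Vp V) c ->
  inu f v \in part L (a (+) c).
Proof. by move=> fa vc; rewrite mem_sub_part inuE; apply: nu_part. Qed.

Lemma instr_ind (P : L -> Prop) :
  (forall k p q, P p -> P q -> P (k *: p + q)) ->
  (forall f v, P (inu f v)) -> forall p, P p.
Proof.
move=> PD Pn p; have P0 : P 0.
  by have := PD (-1) _ _ (Pn 0 0) (Pn 0 0); rewrite scaleN1r addNr.
rewrite -[p]vsvalK.
have /coord_span -> : vsval p \in <<in_tuple
    [seq nu f v | f <- vbasis {:Vm V}, v <- vbasis {:Vp V}]>>%VS.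
  exact: subvsP.
rewrite linear_sum; elim/big_rec: _ => [//|i q _ Pq]; rewrite linearZ.
apply: PD => //=.
have /allpairsP[[f v] [_ _ ->]] : (in_tuple
    [seq nu f v | f <- vbasis {:Vm V}, v <- vbasis {:Vp V}])`_i \in
    [seq nu f v | f <- vbasis {:Vm V}, v <- vbasis {:Vp V}].
  exact: mem_nth.
exact: Pn.
Qed.

Lemma instr_homog_ind (P : L -> Prop) :
  (forall k p q, P p -> P q -> P (k *: p + q)) ->
  (forall a c f v, f \in part (Vm V) a -> v \in part (Vp V) c -> P (inu f v)) ->
  forall p, P p.
Proof.
move=> PD Pn; apply: instr_ind => // f v.
elim/homog_ind: f => [//|f g Hf Hg|a f fa].
  by rewrite -[f]scale1r inu_linl; apply: PD.
elim/homog_ind: v => [//|v w Hv Hw|c v vc]; last exact: Pn fa vc.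
by rewrite -[v]scale1r inu_linr; apply: PD.
Qed.

Lemma pair1_linl k (p q : L) g w :
  pair ((vsval (k *: p + q)).1 g) w
    = k * pair ((vsval p).1 g) w + pair ((vsval q).1 g) w.
Proof.
by rewrite linearP /= add_lfunE scale_lfunE linearP /= add_lfunE scale_lfunE.
Qed.

(** The natural sign is $\eta_{p,g}$. Where the pairing can be nonzero, the
    parity of $p$ is the sum of those of $g$ and $w$; written in terms of these
    the identity is linear in $p$ and need only be checked on $\nu(f,v)$. *)
Lemma instr_skew c e (p : L) g w : g \in part (Vm V) c -> w \in part (Vp V) e ->
  pair ((vsval p).1 g) w = - (eta F (c (+) e) c * pair g ((vsval p).2 w)).
Proof.
move=> gc we; elim/instr_homog_ind: p => [k p q Hp Hq|a d f v fa vd].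
  rewrite pair1_linl Hp Hq linearP /= add_lfunE scale_lfunE linearP /=.
  by rewrite mulrDr opprD mulrN mulrCA.
rewrite inu1 (inu2 _ fa vd) linNZ; have [_ _ _ H _] := GV.
rewrite (H _ _ _ _ _ _ _ _ fa vd gc we) mulrN opprK.
rewrite regularZ.
have [ce|ne] := eqVneq c (d (+) a (+) e).
  rewrite mulrA; congr (_ * _); move: ce.
  by case: (a); case: (c); case: (d); case: (e); signs.
have [_ [_ Gp _] _ _ _] := GV.
by rewrite (hp gc (Gp _ _ _ _ _ _ vd fa we) ne) !mulr0.
Qed.

Lemma instr_graded : graded L.
Proof.
apply: graded_intro => [p|p p0 p1].
  elim/instr_homog_ind: p => [k p q Hp Hq|a c f v fa vc].
    by apply: memvD Hq; apply: memvZ.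
  exact: subvP (part_sub _ _) _ (inu_part fa vc).
rewrite mem_sub_part in p0; rewrite mem_sub_part in p1.
have := introT memv_capP (conj p0 p1).
rewrite (instr_ambient_direct gm gp) memv0 => /eqP e.
by apply: subvs_inj; rewrite e linear0.
Qed.

Lemma instr_faithful_l (p : L) : (forall g, (vsval p).1 g = 0) -> p = 0.
Proof.
move=> p1; apply: subvs_inj; rewrite [vsval p]surjective_pairing.
congr (_, _); first by apply/lfunP => g; rewrite p1 lfunE.
apply/lfunP => w; rewrite lfunE /=.
elim/homog_ind: w => [//|v w Hv Hw|e w we]; first by rewrite linearD /= Hv Hw addr0.
apply: (form_separates ndp) => g; rewrite linear0.
elim/homog_ind: g => [//|f g Hf Hg|c g gc].
  by rewrite linearD add_lfunE Hf Hg addr0.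
have := instr_skew p gc we; rewrite p1 linear0 lfunE /= => /esym/eqP.
by rewrite oppr_eq0 mulf_eq0 signr_eq0 => /eqP.
Qed.

(** The pairing being nondegenerate, the two components of an element
    determine each other. *)
Lemma instr_faithful_r (p : L) : (forall v, (vsval p).2 v = 0) -> p = 0.
Proof.
move=> p2; apply: instr_faithful_l => g.
elim/homog_ind: g => [//|f g Hf Hg|c g gc]; first by rewrite linearD /= Hf Hg addr0.
apply: (form_separates_l ndp) => w; rewrite linear0 lfunE /=.
elim/homog_ind: w => [//|v w Hv Hw|e w we]; first by rewrite linearD /= Hv Hw addr0.
by rewrite (instr_skew p gc we) p2 linear0 mulr0 oppr0.
Qed.

Lemma val2_linP k (p q : L) v :
  (vsval (k *: p + q)).2 v = k *: (vsval p).2 v + (vsval q).2 v.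
Proof. by rewrite linearP /= add_lfunE scale_lfunE. Qed.

Lemma val2Z k (p : L) v : (vsval (k *: p)).2 v = k *: (vsval p).2 v.
Proof. by rewrite linearZ /= scale_lfunE. Qed.

Lemma instr_inj_r (p q : L) :
  (forall v, (vsval p).2 v = (vsval q).2 v) -> p = q.
Proof.
move=> e; apply/eqP; rewrite -subr_eq0; apply/eqP/instr_faithful_r => v.
by rewrite linearB /= add_lfunE opp_lfunE e subrr.
Qed.

(** Supersymmetry with a sign free of the parities of $g$ and $w$: unless their
    sum is the parity of $\nu(f,v)$, both sides vanish. *)
Lemma pair_sym a c f v g w : f \in part (Vm V) a -> v \in part (Vp V) c ->
  pair (Dm V f v g) w = eta F (a (+) c) (a (+) c) * pair (Dm V g w f) v.
Proof.
move=> fa vc.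
elim/homog_ind: g => [//|g h Hg Hh|d g gd].
  by rewrite !linearD /= !add_lfunE linearD add_lfunE Hg Hh mulrDr.
elim/homog_ind: w => [//|w u Hw Hu|e w we].
  by rewrite !linearD /= !add_lfunE linearD add_lfunE Hw Hu mulrDr.
have [[_ Gm _] _ _ _ H] := GV; have [->  _] := H _ _ _ _ _ _ _ _ fa vc gd we.
have [-> //|ne] := eqVneq (d (+) e) (a (+) c).
rewrite (hp (Gm _ _ _ _ _ _ gd we fa) vc) ?mulr0 //.
by move: ne; case: (a); case: (c); case: (d); case: (e).
Qed.

End InnerStructure.

Section InstrForm.
Variables (F : fieldType) (V : superpair F).
Hypothesis GV : GJSP V.

Local Notation instr := (@instr F V).
Local Notation L := (sub_superspace instr).
Local Notation pair := (pform V).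
Local Notation m := (\dim {:Vm V}).
Local Notation n := (\dim {:Vp V}).

(** The map $\nu$ on $\mathcal V^-\otimes\mathcal V^+$, an element of which is
    encoded by the matrix of its coordinates. *)
Definition nu_tensor (S : 'M[F]_(m, n)) : L :=
  \sum_i \sum_j S i j *: inu (ebasis i) (ebasis j).

Definition pair_tensor (p : L) (S : 'M[F]_(m, n)) : F :=
  \sum_i \sum_j S i j * pair ((vsval p).1 (ebasis i)) (ebasis j).

Lemma nu_tensor_lin : linear nu_tensor.
Proof.
move=> k S T; rewrite /nu_tensor scaler_sumr -big_split; apply: eq_bigr => i _.
rewrite /= scaler_sumr -big_split; apply: eq_bigr => j _.
by rewrite !mxE scalerDl scalerA.
Qed.

Lemma pair_tensor_linl k p q S :
  pair_tensor (k *: p + q) S = k * pair_tensor p S + pair_tensor q S.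
Proof.
rewrite /pair_tensor mulr_sumr -big_split; apply: eq_bigr => i _.
rewrite /= mulr_sumr -big_split; apply: eq_bigr => j _.
by rewrite pair1_linl mulrDr mulrCA.
Qed.

Lemma pair_tensor_linr k p S T :
  pair_tensor p (k *: S + T) = k * pair_tensor p S + pair_tensor p T.
Proof.
rewrite /pair_tensor mulr_sumr -big_split; apply: eq_bigr => i _.
rewrite /= mulr_sumr -big_split; apply: eq_bigr => j _ /=.
by rewrite !mxE mulrDl mulrA.
Qed.

(** By supersymmetry, $\langle\nu(f,v)\,\cdot,\cdot\rangle$ only depends on the
    image of a tensor under $\nu$. *)
Lemma pair_tensor0 p S : nu_tensor S = 0 -> pair_tensor p S = 0.
Proof.
move=> S0; elim/(instr_homog_ind GV): p => [k p q Hp Hq|a c f v fa vc].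
  by rewrite pair_tensor_linl Hp Hq mulr0 addr0.
transitivity (eta F (a (+) c) (a (+) c) * pair ((vsval (nu_tensor S)).1 f) v).
  have lin1 : linear (fun q : L => pair ((vsval q).1 f) v : F^o).
    by move=> k p q; apply: pair1_linl.
  rewrite -(linfun_val lin1) !linear_sum mulr_sumr; apply: eq_bigr => i _.
  rewrite !linear_sum mulr_sumr; apply: eq_bigr => j _ /=.
  rewrite linearZ /= (linfun_val lin1) regularZ !inu1 (pair_sym GV _ _ fa vc).
  by rewrite mulrCA.
by rewrite S0 linear0 lfunE linear0 lfunE mulr0.
Qed.

Definition simple_tensor (g : Vm V) (w : Vp V) : 'M[F]_(m, n) :=
  \matrix_(i, j) (coord (vbasis {:Vm V}) i g * coord (vbasis {:Vp V}) j w).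

Lemma nu_simple_tensor g w : nu_tensor (simple_tensor g w) = inu g w.
Proof.
have l1 u : linear ((@inu F V)^~ u) by move=> k f h; apply: inu_linl.
have l2 f : linear (@inu F V f) by move=> k u v; apply: inu_linr.
rewrite {2}(ebasis_gen g) -[inu _ w](linfun_val (l1 w)) linear_sum.
apply: eq_bigr => i _; rewrite linearZ /= (linfun_val (l1 w)).
rewrite {2}(ebasis_gen w) -(linfun_val (l2 (ebasis i))) linear_sum scaler_sumr.
apply: eq_bigr => j _; rewrite linearZ /= (linfun_val (l2 _)) scalerA.
by rewrite mxE.
Qed.

Lemma pair_simple_tensor p g w :
  pair_tensor p (simple_tensor g w) = pair ((vsval p).1 g) w.
Proof.
rewrite {2}(ebasis_gen g) !linear_sum sum_lfunE; apply: eq_bigr => i _.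
rewrite {2}(ebasis_gen w) linear_sum; apply: eq_bigr => j _.
rewrite mxE /= linearZ /= linearZ /= linearZ /= scale_lfunE !regularZ.
by rewrite mulrCA mulrA.
Qed.

(** Every element of the inner structure superalgebra is the image of a tensor;
    the form is defined on tensors, through any linear choice of preimages. *)
Lemma instr_form_exists : exists b, @is_instr_form F V b.
Proof.
have tl := nu_tensor_lin.
pose T := linfun nu_tensor.
have TE S : T S = nu_tensor S by apply: linfun_val.
have onto : limg T = fullv.
  apply/eqP; rewrite eqEsubv subvf; apply/subvP => p _.
  elim/instr_ind: p => [k p q Hp Hq|f v]; first by rewrite rpredD // rpredZ.
  by rewrite -nu_simple_tensor -TE memv_img // memvf.
pose f (p q : L) : F^o := pair_tensor p ((T^-1)%VF q).
have fE p g w : f p (inu g w) = pair ((vsval p).1 g) w.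
  rewrite /f -pair_simple_tensor; apply/eqP; rewrite -subr_eq0; apply/eqP.
  set S := simple_tensor g w; set S' := (T^-1)%VF _.
  transitivity (pair_tensor p ((-1) *: S + S')).
    by rewrite pair_tensor_linr mulN1r addrC.
  apply: pair_tensor0; rewrite nu_tensor_lin -!TE limg_lfunVK ?onto ?memvf //.
  by rewrite TE nu_simple_tensor scaleN1r addNr.
exists (linfun2 f) => p q g v h w Ep Eq; rewrite linfun2E.
- have -> : q = inu h w by apply: subvs_inj; rewrite inuE.
  by rewrite fE Ep.
- by move=> p' k q1 q2; rewrite /f linearP pair_tensor_linr.
by move=> q' k p1 p2; rewrite /f pair_tensor_linl.
Qed.

Lemma instr_formE b p g w : is_instr_form b ->
  b p (inu g w) = pair ((vsval p).1 g) w.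
Proof.
move=> bE; elim/instr_ind: p => [k p q Hp Hq|f v].
  by rewrite form_linl Hp Hq pair1_linl.
by rewrite inu1; apply: bE; apply: inuE.
Qed.

Lemma instr_form_unique b b' : @is_instr_form F V b -> is_instr_form b' -> b = b'.
Proof.
move=> bE bE'; apply/lfunP => p; apply/lfunP => q.
elim/instr_ind: q => [k q r Hq Hr|g w]; first by rewrite !form_linr Hq Hr.
by rewrite !instr_formE.
Qed.

End InstrForm.

Section InstrModule.
Variables (F : fieldType) (V : superpair F).
Hypothesis GV : GJSP V.
Local Notation instr := (@instr F V).
Local Notation L := (sub_superspace instr).
Local Notation pair := (pform V).
Variable b : 'Hom(L, 'Hom(L, F^o)).
Hypothesis bE : is_instr_form b.

Let gm : graded (Vm V). Proof. by case: GV => -[]. Qed.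
Let gp : graded (Vp V). Proof. by case: GV => _ []. Qed.
Let ndp : nondegenerate pair. Proof. by case: GV => _ _ []. Qed.
Let hp : homogeneous_form pair. Proof. by case: GV => _ _ []. Qed.
Let gL : graded L. Proof. exact: instr_graded. Qed.

Local Notation "[ p , q ]" := (@instr_br F V p q) : ring_scope.

Lemma val_br a c (p q : L) : p \in part L a -> q \in part L c ->
  vsval [p, q] = emul (vsval p) (vsval q) - eta F a c *: emul (vsval q) (vsval p).
Proof.
rewrite !mem_sub_part => pa qc; rewrite instr_brE //.
exact: sbr_homogE gm gp pa qc.
Qed.

Lemma br1 a c (p q : L) g : p \in part L a -> q \in part L c ->
  (vsval [p, q]).1 g = (vsval p).1 ((vsval q).1 g)
                       - eta F a c *: (vsval q).1 ((vsval p).1 g).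
Proof.
move=> pa qc; rewrite (val_br pa qc) /= add_lfunE opp_lfunE scale_lfunE.
by rewrite !comp_lfunE.
Qed.

Lemma br2 a c (p q : L) v : p \in part L a -> q \in part L c ->
  (vsval [p, q]).2 v = (vsval p).2 ((vsval q).2 v)
                       - eta F a c *: (vsval q).2 ((vsval p).2 v).
Proof.
move=> pa qc; rewrite (val_br pa qc) /= add_lfunE opp_lfunE scale_lfunE.
by rewrite !comp_lfunE.
Qed.

Lemma part1 a c (p : L) g : p \in part L a -> g \in part (Vm V) c ->
  (vsval p).1 g \in part (Vm V) (a (+) c).
Proof.
by rewrite mem_sub_part mem_prod_part => /andP[/mem_end_part H _]; apply: H.
Qed.

Lemma part2 a c (p : L) v : p \in part L a -> v \in part (Vp V) c ->
  (vsval p).2 v \in part (Vp V) (a (+) c).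
Proof.
by rewrite mem_sub_part mem_prod_part => /andP[_ /mem_end_part H]; apply: H.
Qed.

Lemma instr_br_part a c (p q : L) : p \in part L a -> q \in part L c ->
  [p, q] \in part L (a (+) c).
Proof.
move=> pa qc; rewrite mem_sub_part mem_prod_part; apply/andP; split.
  apply/mem_end_part => d x xd; rewrite (br1 _ pa qc) rpredB ?rpredZ //.
    by rewrite -addbA; apply/part1/part1.
  by rewrite -addbA addbCA; apply/part1/part1.
apply/mem_end_part => d x xd; rewrite (br2 _ pa qc) rpredB ?rpredZ //.
  by rewrite -addbA; apply/part2/part2.
by rewrite -addbA addbCA; apply/part2/part2.
Qed.

Lemma instr_lie : is_lie_superalgebra (@instr_br F V).
Proof.
split; [exact: gL | exact: instr_br_part | |].
  move=> a c x y xa yc; apply: (instr_inj_r GV) => v.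
  rewrite -scaleNr val2Z (br2 _ xa yc) (br2 _ yc xa) scaleNr scalerBr opprB scalerA.
  by case: (a); case: (c); signs; rewrite ?scale1r.
move=> a c d x y z xa yc zd; apply: (instr_inj_r GV) => v.
have yz := instr_br_part yc zd; have xz := instr_br_part xa zd.
have xy := instr_br_part xa yc.
rewrite addrC val2_linP addrC.
have BZ (p : L) k u w : (vsval p).2 (u - k *: w)
    = (vsval p).2 u - k *: (vsval p).2 w by rewrite linearB linearZ.
rewrite (br2 _ xa yz) !(br2 _ yc zd) (br2 _ xy zd) !(br2 _ xa yc).
rewrite (br2 _ yc xz) !(br2 _ xa zd) !BZ !scalerBr !scalerA.
have -> : eta F a c * eta F c (a (+) d) = eta F c d.
  by case: (a); case: (c); case: (d); signs.
have -> : eta F a (c (+) d) = eta F a c * eta F a d.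
  by case: (a); case: (c); case: (d); signs.
have -> : eta F (a (+) c) d * eta F a c = eta F a c * eta F a d * eta F c d.
  by case: (a); case: (c); case: (d); signs.
have -> : eta F (a (+) c) d = eta F c d * eta F a d.
  by case: (a); case: (c); case: (d); signs.
by rewrite !opprB [in RHS]addrACA !subrKA addrACA [in RHS]addrACA [- _ - _]addrC.
Qed.


Lemma instr_module : is_supermodule (@instr_br F V) (@instr_act F V).
Proof.
split; [exact: gp | move=> a c x v xa vc | move=> a c x y v xa yc].
  by rewrite instr_actE; apply: part2.
by rewrite !instr_actE (br2 _ xa yc).
Qed.

(** [pair_sym] for $\nu(f,v)$ extends to all elements of parity $a$ once the
    component of parity $a$ is made explicit. *)
Lemma instr_form_sym_hom a x y : x \in part L a -> b x y = eta F a a * b y x.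
Proof.
move=> xa; have -> : x = hcomp L a x by rewrite (hcomp_id a gL xa) eqxx.
elim/(instr_homog_ind GV): x {xa} => [k p q Hp Hq|c d f v fc vd].
  by rewrite linearP form_linl form_linr Hp Hq mulrDr mulrCA.
rewrite (hcomp_id a gL (inu_part GV fc vd)).
have [->|_] := eqVneq a; last by rewrite !linear0 lfunE mulr0.
elim/instr_ind: y => [k p q Hp Hq|g w].
  by rewrite form_linl form_linr Hp Hq mulrDr mulrCA.
by rewrite !(instr_formE _ _ _ bE) !inu1 (pair_sym GV _ _ fc vd).
Qed.

Lemma instr_form_homogeneous : homogeneous_form b.
Proof.
move=> a c x y xa yc ac.
have -> : y = hcomp L (~~ a) y.
  by rewrite (hcomp_id _ gL yc); move: ac; case: (a); case: (c).
elim/(instr_homog_ind GV): y {yc} => [k p q Hp Hq|d e g w gd we].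
  by rewrite linearP form_linr Hp Hq mulr0 addr0.
rewrite (hcomp_id _ gL (inu_part GV gd we)).
case: eqVneq => [na|_]; last by rewrite linear0.
rewrite (instr_formE _ _ _ bE) (hp (part1 xa gd) we) //.
by move: na; case: (a); case: (d); case: (e).
Qed.

Lemma instr_form_sym a c x y : x \in part L a -> y \in part L c ->
  b x y = eta F a c * b y x.
Proof.
move=> xa yc; have [<-|ac] := eqVneq a c; first exact: instr_form_sym_hom.
by rewrite (instr_form_homogeneous xa yc ac)
           (instr_form_homogeneous yc xa) ?mulr0 // eq_sym.
Qed.

Lemma instr_form_nondegenerate : nondegenerate b.
Proof.
have ndl x : (forall y, b x y = 0) -> x = 0.
  move=> x0; apply: (instr_faithful_l GV) => g.
  apply: (form_separates_l ndp) => w.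
  by rewrite -(instr_formE _ _ _ bE) x0 linear0 lfunE.
split=> // y y0; apply: ndl => x.
elim/homog_ind: x => [//|u v Hu Hv|a x xa]; first by rewrite linearD /= Hu Hv addr0.
have := instr_form_sym_hom y xa; rewrite y0 => /esym/eqP.
by rewrite mulf_eq0 signr_eq0 => /eqP.
Qed.

(** With this formula, invariance of the form becomes superinvariance of the
    pairing. *)
Lemma br_inu c d d' e f v g w :
  f \in part (Vm V) c -> v \in part (Vp V) d ->
  g \in part (Vm V) d' -> w \in part (Vp V) e ->
  [inu f v, inu g w]
    = (- eta3 F c d d') *: inu g (Dp V v f w) + inu (Dm V f v g) w.
Proof.
move=> fc vd gd we; apply: subvs_inj; rewrite instr_brE // !inuE.
by rewrite (sbr_nu GV fc vd gd we) linearP [in RHS]/= !inuE scaleNr addrC.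
Qed.

Lemma instr_form_invariant x y z : b [x, y] z = b x [y, z].
Proof.
elim/homog_ind: x => [//|x x' Hx Hx'|a x xa].
  by rewrite -[x]scale1r bilin_linl !form_linl Hx Hx'.
elim/(instr_homog_ind GV): y => [k p q Hp Hq|c d f v fc vd].
  by rewrite bilin_linr form_linl Hp Hq bilin_linl form_linr.
have yP := inu_part GV fc vd.
elim/(instr_homog_ind GV): z => [k p q Hp Hq|d' e g w gd we].
  by rewrite form_linr bilin_linr form_linr Hp Hq.
rewrite (br_inu fc vd gd we) form_linr !(instr_formE _ _ _ bE).
rewrite (br1 _ xa yP) !inu1 -scaleNr addrC form_linl; congr (_ + _).
have [_ _ _ H _] := GV; rewrite (H _ _ _ _ _ _ _ _ fc vd (part1 xa gd) we) mulrA.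
by congr (_ * _); case: (a); case: (c); case: (d); case: (d'); signs.
Qed.

Lemma instr_FLSM : FLSM (instr_lsm b).
Proof.
split; first exact: instr_lie.
  split; first exact: instr_module.
  by move=> p p0; apply: (instr_faithful_r GV) => v; rewrite -instr_actE p0.
split.
- exact: instr_form_nondegenerate.
- exact: instr_form_homogeneous.
- exact: instr_form_invariant.
- exact: instr_form_sym.
Qed.

Local Notation FX := (faulkner (instr_lsm b)).
Local Notation M' := (dual_superspace (Vp V)).

(** The pairing identifies $\mathcal V^-$ with the dual of $\mathcal V^+$ as a
    module over the inner structure superalgebra. *)
Lemma dual_act_pair (p : L) x : dual_act (@instr_act F V) p (pair x)
  = pair ((vsval p).1 x).
Proof.
apply/lfunP => v.
elim/homog_ind: p => [//|p q Hp Hq|a p pa].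
  rewrite -[p]scale1r bilin_linl add_lfunE scale_lfunE Hp Hq.
  by rewrite pair1_linl mul1r scale1r.
elim/homog_ind: x => [//|x y Hx Hy|c x xc].
  by rewrite !linearD /= !add_lfunE Hx Hy.
elim/homog_ind: v => [//|v w Hv Hw|e v ve].
  have D (h : 'Hom(Vp V, F^o)) : h (v + w) = h v + h w by rewrite linearD.
  by rewrite !D Hv Hw.
have xc' : (pair x : M') \in part M' c.
  apply/mem_dual_part => w wc; apply: hp xc wc _; by case: (c).
rewrite (dual_act_homogE _ _ gL gp pa xc') instr_actE (instr_skew GV p xc ve).
have [ce|ne] := eqVneq c (a (+) e); last by rewrite (hp xc (part2 pa ve) ne) !mulr0.
by congr (- (_ * _)); rewrite ce; case: (a); case: (e); signs.
Qed.

(** In the Faulkner construction over the inner structure superalgebra,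
    $[f,v]$ is $\nu(f,v)$. *)
Lemma fvbr_instr x v : fvbr (instr_lsm b) (pair x) v = inu x v.
Proof.
apply: (form_separates instr_form_nondegenerate) => p.
rewrite (form_fvbr instr_FLSM) (instr_formE _ _ _ bE).
by rewrite -dual_act_pair.
Qed.

Lemma vfbr_instr v x w : act (instr_lsm b) (vfbr (instr_lsm b) v (pair x)) w
  = Dp V v x w.
Proof.
elim/homog_ind: x => [//|x y Hx Hy|c x xc].
  rewrite -[x]scale1r [pair _]linearP [vfbr _ _ _]bilin_linr bilin_linl Hx Hy.
  by rewrite bilin_linr add_lfunE scale_lfunE.
elim/homog_ind: v => [//|u v Hu Hv|e v ve].
  by rewrite -[u]scale1r !bilin_linl add_lfunE scale_lfunE Hu Hv.
have xc' : (pair x : M') \in part M' c.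
  apply/mem_dual_part => u uc; apply: hp xc uc _; by case: (c).
rewrite (vfbr_fvbr instr_FLSM ve xc') fvbr_instr bilinNZl [X in X w]/=.
rewrite instr_actE (inu2 GV w xc ve) scalerN opprK scalerA.
by case: (c); case: (e); signs; rewrite scale1r.
Qed.

Lemma faulkner_instr : superpair_iso FX V.
Proof.
have inj := form_inj ndp.
have onto : limg pair = fullv.
  apply/eqP; rewrite eqEdim subvf /= limg_dim_eq ?(eqP inj) ?capv0 //.
  rewrite dim_dual -(dim_dual (Vm V)) -(@limg_dim_eq _ _ _ (flip pair) fullv).
    exact/dimvS/subvf.
  by rewrite (eqP (form_flip_inj ndp)) capv0.
have pK : cancel pair (pair^-1)%VF := lker0_lfunK inj.
have Kp : cancel (pair^-1)%VF pair.
  by move=> f; apply: limg_lfunVK; rewrite onto memvf.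
exists (pair^-1)%VF, \1%VF; split.
- split; split; first by exists pair.
  + move=> a f fa; set y := (pair^-1)%VF f.
    suff z : hcomp (Vm V) (~~ a) y = 0.
      have := hcomp_mem a y; have := hcomp_sum y gm.
      by case: (a) z => /= ->; rewrite ?addr0 ?add0r => <-.
    apply: (form_separates_l ndp) => v; rewrite linear0 lfunE.
    rewrite (form_hcomp gm gp hp) Kp.
    by move/mem_dual_part: fa; apply; apply: hcomp_mem.
  + by exists id => v; rewrite id_lfunE.
  by move=> a v va; rewrite id_lfunE.
- move=> x y z; rewrite -[x]Kp -[z]Kp; set x' := (pair^-1)%VF x.
  rewrite (faulkner_Dm instr_FLSM) fvbr_instr dual_act_pair !pK inu1 id_lfunE.
  by [].
- move=> x y z; rewrite !id_lfunE -[y]Kp (faulkner_Dp instr_FLSM) vfbr_instr.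
  by rewrite Kp.
by move=> f v; rewrite id_lfunE faulkner_formE Kp.
Qed.

End InstrModule.

Lemma instr_FLM (F : fieldType) (V : superpair F) b :
  GJP V -> is_instr_form b -> FLM (@instr_lsm F V b).
Proof.
case=> GV m0 p0 bE; split; [exact: instr_FLSM | | exact: p0].
have [[gm _ _] [gp _ _] _ _ _] := GV.
apply/eqP; rewrite -subv0; apply/subvP=> q qa; rewrite memv0; apply/eqP.
apply: (instr_faithful_l GV) => g.
have := part1 qa (c := false) (g := g).
rewrite purely_even_full // memvf m0 => /(_ isT).
by rewrite memv0 => /eqP.
Qed.

(** * The correspondence on isomorphism classes *)

Section IsomorphismClasses.
Variable F : fieldType.
Implicit Types (X Y : lsm F) (V W : superpair F).

Lemma superpair_iso_sym V W : GJSP V -> GJSP W ->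
  superpair_iso V W -> superpair_iso W V.
Proof.
move=> /GJSP_graded[gmV gpV] /GJSP_graded[gmW gpW].
move=> /(superpair_isoP gmV gmW gpV gpW)[h1 [h2 H]].
apply/superpair_isoP => //.
have [[[[k1 [hk1 kh1]] _] [[k2 [hk2 kh2]] _]] _ _ _] := H.
by exists k1, k2; apply: iso_superpair_inv H _ _ _ _.
Qed.

Lemma superpair_iso_trans V W Z : GJSP V -> GJSP W -> GJSP Z ->
  superpair_iso V W -> superpair_iso W Z -> superpair_iso V Z.
Proof.
move=> /GJSP_graded[gmV gpV] /GJSP_graded[gmW gpW] /GJSP_graded[gmZ gpZ].
move=> /(superpair_isoP gmV gmW gpV gpW)[h1 [h2 H]].
move=> /(superpair_isoP gmW gmZ gpW gpZ)[k1 [k2 K]].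
apply/superpair_isoP => //.
by exists (h1 *m k1), (h2 *m k2); apply: iso_superpair_comp H K.
Qed.

Lemma faulkner_isoP X Y : FLSM X -> FLSM Y ->
  lsm_iso X Y <-> superpair_iso (faulkner X) (faulkner Y).
Proof.
move=> FX FY.
have [gLX gMX] := FLSM_graded FX; have [gLY gMY] := FLSM_graded FY.
have [gmX gpX] := GJSP_graded (faulkner_GJSP FX).
have [gmY gpY] := GJSP_graded (faulkner_GJSP FY).
split.
  move=> /(lsm_isoP gLX gLY gMX gMY)[g1 [g2 G]].
  apply/superpair_isoP => //.
  by have [h1 H] := iso_lsm_faulkner FX FY G; exists h1, g2.
move=> /(superpair_isoP gmX gmY gpX gpY)[h1 [h2 H]].
apply/lsm_isoP => //.
by have [g1 G] := iso_superpair_faulkner FX FY H; exists g1, h2.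
Qed.

(** The inner structure superalgebra is a right inverse on isomorphism classes;
    since the Faulkner construction reflects isomorphism, it is a two-sided
    inverse and respects isomorphism. *)
Lemma faulkner_bijection :
  iso_class_bijection (@FLSM F) (@lsm_iso F) (@GJSP F) (@superpair_iso F)
    (@faulkner_of F) (@instr_of F).
Proof.
have FI V X : GJSP V -> instr_of V X ->
    FLSM X /\ superpair_iso (faulkner X) V.
  by move=> GV [b bE ->]; split; [apply: instr_FLSM | apply: faulkner_instr].
split.
- split.
  + by move=> X _; exists (faulkner X).
  + by move=> X _ FX ->; apply: faulkner_GJSP.
  + by move=> X Y _ _ FX FY -> -> XY; apply/(faulkner_isoP FX FY).
- split.
  + move=> V GV; have [b bE] := instr_form_exists GV.
    by exists (instr_lsm b), b.
  + by move=> V X GV VX; have [] := FI V X GV VX.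
  + move=> V W X Y GV GW /(FI _ _ GV)[FX XV] /(FI _ _ GW)[FY YW] VW.
    have GX := faulkner_GJSP FX; have GY := faulkner_GJSP FY.
    apply/faulkner_isoP => //; apply: superpair_iso_trans XV _ => //.
    apply: superpair_iso_trans VW _ => //.
    exact: superpair_iso_sym.
- move=> X V Y FX -> /(FI _ _ (faulkner_GJSP FX))[FY YX].
  exact/faulkner_isoP.
by move=> V X W GV /(FI _ _ GV)[_ XV] ->.
Qed.

Lemma faulkner_bijection_even :
  iso_class_bijection (@FLM F) (@lsm_iso F) (@GJP F) (@superpair_iso F)
    (@faulkner_of F) (@instr_of F).
Proof.
have [[t1 p1 c1] [t2 p2 c2] e1 e2] := faulkner_bijection.
have FF X : FLM X -> FLSM X by case.
have GG V : GJP V -> GJSP V by case.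
split.
- split.
  + by move=> X /FF /t1.
  + by move=> X _ FX ->; apply: faulkner_GJP.
  + by move=> X Y V W /FF FX /FF FY; apply: c1.
- split.
  + by move=> V /GG /t2.
  + by move=> V _ GV [b bE ->]; apply: instr_FLM.
  + by move=> V W X Y /GG GV /GG GW; apply: c2.
- by move=> X V Y /FF; apply: e1.
by move=> V X W /GG; apply: e2.
Qed.

End IsomorphismClasses.

(** * The automorphism schemes *)

Section BaseChange.
Variables (F : fieldType) (R S : kalgebra F) (psi : khom R S).

Lemma map_ext (U : vectType F) (x : U) : map_mx psi (ext R x) = ext S x.
Proof. by apply/rowP => i; rewrite !mxE kfun_str. Qed.

Lemma map_ext_hom (U W : vectType F) (f : 'Hom(U, W)) :
  map_mx psi (ext_hom R f) = ext_hom S f.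
Proof.
by apply/matrixP => i j; rewrite !mxE kfun_str.
Qed.

Lemma map_ext_form (U V : vectType F) (b : 'Hom(U, 'Hom(V, F^o))) u v :
  psi (ext_form b u v) = ext_form b (map_mx psi u) (map_mx psi v).
Proof.
rewrite rmorph_sum; apply: eq_bigr => i _; rewrite rmorph_sum.
by apply: eq_bigr => j _; rewrite !rmorphM kfun_str !mxE.
Qed.

Lemma iso_mx_map n m (A : 'M[R]_(n, m)) : iso_mx A -> iso_mx (map_mx psi A).
Proof.
by case=> B [AB BA]; exists (map_mx psi B); rewrite -!map_mxM AB BA !map_mx1.
Qed.

End BaseChange.

Section SchemeIsomorphisms.
Variable F : fieldType.

Lemma group_scheme_iso_trans n1 m1 n2 m2 n3 m3
    (P : mxfunctor F n1 m1) (Q : mxfunctor F n2 m2) (T : mxfunctor F n3 m3) :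
  group_scheme_iso P Q -> group_scheme_iso Q T -> group_scheme_iso P T.
Proof.
case=> f [fPQ fM fI fS fN] [g [gQT gM gI gS gN]].
exists (fun R x => g R (f R x)); split.
- by move=> R x /fPQ /gQT.
- by move=> R x y Px Py; rewrite fM // gM //; apply: fPQ.
- by move=> R x y Px Py e; apply: fI => //; apply: gI => //; apply: fPQ.
- move=> R z /gS[y Qy <-]; have [x Px <-] := fS _ _ Qy.
  by exists x.
by move=> R S psi x Px; rewrite fN // gN //; apply: fPQ.
Qed.

(** The extension to $R$ of an isomorphism acts by conjugation on matrices. *)
Lemma Aut_superpair_iso (V W : superpair F) : GJSP V -> GJSP W ->
  superpair_iso V W -> group_scheme_iso (Aut_superpair V) (Aut_superpair W).
Proof.
move=> /GJSP_graded[gmV gpV] /GJSP_graded[gmW gpW].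
case=> a [c [[ea ec] Hm Hp Hb]].
have [a' [aK Ka]] := hom_inverse ea.1; have [c' [cK Kc]] := hom_inverse ec.1.
pose A R := ext_hom R a; pose A' R := ext_hom R a'.
pose C R := ext_hom R c; pose C' R := ext_hom R c'.
have inv (R : kalgebra F) (U Z : vectType F) (f : 'Hom(U, Z)) (g : 'Hom(Z, U)) :
    cancel f g -> ext_hom R f *m ext_hom R g = 1%:M.
  by move=> fK; apply: row_ext => x; rewrite mulmxA !ext_homE fK mulmx1.
have AC R : iso_superpair (R := R) (V := V) (W := W) (A R) (C R).
  exact: iso_superpair_hom.
have AC' R : iso_superpair (R := R) (V := W) (W := V) (A' R) (C' R).
  by apply: iso_superpair_inv (AC R) _ _ _ _; rewrite ?inv.
exists (fun R h => (A' R *m h.1 *m A R, C' R *m h.2 *m C R)); split.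
- move=> R h /Aut_superpairE H; apply/Aut_superpairE.
  exact: iso_superpair_comp (iso_superpair_comp (AC' R) H) (AC R).
- move=> R g h _ _; congr (_, _) => /=; rewrite !mulmxA.
    by rewrite -[_ *m A R *m A' R]mulmxA inv // mulmx1.
  by rewrite -[_ *m C R *m C' R]mulmxA inv // mulmx1.
- move=> R [g1 g2] [h1 h2] _ _ /= [e1 e2]; congr (_, _).
    have := congr1 (fun B => A R *m B *m A' R) e1.
    by rewrite !mulmxA inv // !mul1mx -!mulmxA inv // !mulmx1.
  have := congr1 (fun B => C R *m B *m C' R) e2.
  by rewrite !mulmxA inv // !mul1mx -!mulmxA inv // !mulmx1.
- move=> R [k1 k2] /Aut_superpairE H.
  exists (A R *m k1 *m A' R, C R *m k2 *m C' R).
    apply/Aut_superpairE.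
    exact: iso_superpair_comp (iso_superpair_comp (AC R) H) (AC' R).
  congr (_, _) => /=; rewrite !mulmxA inv // mul1mx -mulmxA inv // mulmx1 //.
by move=> R S psi h _; rewrite /mxmap /= !map_mxM !map_ext_hom.
Qed.

Variable X : lsm F.
Hypothesis FX : FLSM X.
Local Notation M := (smod X).
Local Notation M' := (dual_superspace M).
Local Notation pair := (ext_form (pform (faulkner X))).

Definition preserves_pairing (R : kalgebra F) (A : 'M[R]_(\dim {:M'}))
    (B : 'M[R]_(\dim {:M})) : Prop :=
  forall f v, pair (f *m A) (v *m B) = pair f v.

(** The contragredient of $B$, unique by [contraE]. It is chosen by description
    because only the existence of the inverse of $B$ is given. *)
Definition contra (R : kalgebra F) (B : 'M[R]_(\dim {:M})) : 'M[R]_(\dim {:M'}) :=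
  epsilon (inhabits 0) (fun A => preserves_pairing A B).

Lemma contraE (R : kalgebra F) A (B : 'M[R]_(\dim {:M})) :
  iso_mx B -> preserves_pairing A B -> contra B = A.
Proof.
move=> iB AB; apply: (pair_adjoint_inj iB) (AB).
apply: (epsilon_spec (inhabits 0) (fun A => preserves_pairing A B)).
by exists A.
Qed.

Lemma preserves_pairing_map (R S : kalgebra F) (psi : khom R S) A B :
  @preserves_pairing R A B ->
  preserves_pairing (map_mx psi A) (map_mx psi B).
Proof.
move=> AB; elim/ext_ind => [k f g Hf Hg|f] v; first by rewrite !extlinE Hf Hg.
elim/ext_ind: v => [k v w Hv Hw|v]; first by rewrite !extlinE Hv Hw.
by rewrite -!(map_ext psi) -!map_mxM -!map_ext_form AB.
Qed.

(** $(\varphi_0,\varphi^+)\mapsto((\varphi^+)^{-*},\varphi^+)$, where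
    $\varphi_0$ can be recovered from $\varphi^+$. *)
Lemma Aut_faulkner :
  group_scheme_iso (Aut_lsm X) (Aut_superpair (faulkner X)).
Proof.
have pres (R : kalgebra F) g : Aut_lsm X R g ->
    Aut_superpair (faulkner X) R (contra g.2, g.2).
  move=> /Aut_lsmE G; have [h1 H] := iso_lsm_faulkner FX FX G.
  have [[_ [i2 _]] _ _ E] := H.
  by apply/Aut_superpairE; rewrite (contraE i2 E).
have iso2 (R : kalgebra F) g : Aut_lsm X R g -> iso_mx g.2.
  by case=> -[_ []].
have cP (R : kalgebra F) g : Aut_lsm X R g -> preserves_pairing (contra g.2) g.2.
  by move=> /pres[].
exists (fun R g => (contra g.2, g.2)); split => //.
- move=> R g h G H; congr (_, _); apply: contraE.
    by apply: iso_mx_mul; apply: iso2.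
  by move=> f v; rewrite !mulmxA !cP.
- move=> R [g1 g2] [h1 h2] /Aut_lsmE G /Aut_lsmE H [_ e]; move: G H; rewrite /= e.
  by move=> G H; rewrite (iso_lsm_inj FX G H).
- move=> R [h1 h2] /Aut_superpairE H.
  have [g1 G] := iso_superpair_faulkner FX FX H.
  exists (g1, h2); first exact/Aut_lsmE.
  by have [[_ [i2 _]] _ _ E] := H; rewrite (contraE i2 E).
move=> R S psi g G; congr (_, _); apply: contraE.
  exact/iso_mx_map/iso2.
exact/preserves_pairing_map/cP.
Qed.

End SchemeIsomorphisms.

Theorem theorem3p6 (F : fieldType) (charF : 2%N \notin [pchar F]) :
  [/\ forall V : superpair F, GJSP V -> exists! b, @is_instr_form F V b,
      iso_class_bijection (@FLSM F) (@lsm_iso F) (@GJSP F) (@superpair_iso F)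
        (@faulkner_of F) (@instr_of F),
      iso_class_bijection (@FLM F) (@lsm_iso F) (@GJP F) (@superpair_iso F)
        (@faulkner_of F) (@instr_of F)
    & forall (X : lsm F) (V : superpair F),
        FLSM X -> GJSP V -> associated X V ->
        group_scheme_iso (Aut_lsm X) (Aut_superpair V)].
Proof.
split.
- move=> V GV; have [b bE] := instr_form_exists GV.
  by exists b; split=> // b'; apply: instr_form_unique.
- exact: faulkner_bijection.
- exact: faulkner_bijection_even.
move=> X V FX GV XV.
apply: group_scheme_iso_trans (Aut_faulkner FX) _.
exact: Aut_superpair_iso (faulkner_GJSP FX) GV XV.
Qed.
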